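(* Let $K$ be a field and $S=K[x_1,\ldots,x_n]$. Suppose that $\operatorname{hreg}(I)\leq\operatorname{reg}(I)$ for all nonzero monomial ideals $I\subset S$ with linear resolution. Then $\operatorname{hreg}(I)\leq\operatorname{reg}(I)$ for all nonzero monomial ideals $I\subset S$.
   Context: $\operatorname{reg}(I)$ is the Castelnuovo--Mumford regularity of $I$ as a graded $S$-module (standard grading), i.e. $\operatorname{reg}(I)=\max\{j-i : \operatorname{Tor}_i^S(I,K)_j\neq 0\}$. The ideal $I$ has a linear resolution if for some $k$ it is generated in degree $k$ and $\operatorname{reg}(I)=k$. For $c\in\mathbb{N}^n$ ($\mathbb{N}$ the nonnegative integers), $x^c=x_1^{c(1)}\cdots x_n^{c(n)}$ and $|c|=\sum_i c(i)$. For a nonzero monomial ideal $I\subset S$, a Stanley decomposition of $I$ is a decomposition $\mathcal{D}: I=\bigoplus_{i=1}^r x^{c_i}K[Z_i]$ as a finite direct sum of $K$-subspaces, where $c_i\in\mathbb{N}^n$, $x^{c_i}\in I$, $Z_i\subset\{x_1,\ldots,x_n\}$, and $x^{c_i}K[Z_i]$ is the $K$-span of all $x^{c_i}u$ with $u$ a monomial in $K[Z_i]$. Set $\operatorname{hreg}(\mathcal{D})=\max\{|c_i| : i=1,\ldots,r\}$ and $\operatorname{hreg}(I)=\min\{\operatorname{hreg}(\mathcal{D}) : \mathcal{D}\text{ is a Stanley decomposition of } I\}$. *)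

(* Defs.v *)
From Stdlib Require Import ClassicalEpsilon.
From HB Require Import structures.
From mathcomp Require Import all_boot all_order all_algebra.
From mathcomp Require Import mpoly.

Set Implicit Arguments.
Unset Strict Implicit.
Unset Printing Implicit Defensive.

Import Order.TTheory GRing.Theory Num.Theory.
Local Open Scope ring_scope.

(* [epsilon] returns an arbitrary value when the maximum (minimum) does not
   exist; below it is applied to sets that do have one. *)
Definition max_int (A : int -> Prop) : int :=
  epsilon (inhabits 0) (fun r => A r /\ forall s, A s -> s <= r).

Definition min_nat (A : nat -> Prop) : nat :=
  epsilon (inhabits 0%N) (fun h => A h /\ forall s, A s -> (h <= s)%N).

Section Ideals.
Variables (K : fieldType) (n : nat).
Local Notation S := {mpoly K[n]}.

Definition ideal_gen (G : S -> Prop) (p : S) : Prop :=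
  exists s : seq (S * S),
    (forall fg, fg \in s -> G fg.2) /\ p = \sum_(fg <- s) fg.1 * fg.2.

(* The unit ideal is allowed. *)
Definition monomial_ideal (I : S -> Prop) : Prop :=
  exists A : 'X_{1..n} -> Prop,
    forall p, I p <-> ideal_gen (fun g => exists2 a, A a & g = 'X_[a]) p.

Definition nonzero_ideal (I : S -> Prop) : Prop := exists2 p, I p & p != 0.

Definition generated_in_degree (I : S -> Prop) (k : nat) : Prop :=
  forall p, I p <-> ideal_gen (fun g => I g /\ g \is k.-homog) p.

(* Degrees of graded modules are integers; 0 is homogeneous of every degree. *)
Definition homogz (d : int) (p : S) : Prop :=
  forall m, m \in msupp p -> (mdeg m)%:Z = d.

(* A resolution ... -> F_1 -> F_0 -> I -> 0 by finitely generated graded free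
   modules F_i = \bigoplus_k S(- gfr_shift i k), with maps of degree 0. Elements
   of F_i are row vectors, on which the matrices act by right multiplication. *)
Record graded_free_resolution (I : S -> Prop) := GradedFreeResolution {
  gfr_rank : nat -> nat;
  gfr_shift : forall i, 'I_(gfr_rank i) -> int;
  gfr_aug : 'cV[S]_(gfr_rank 0);
  gfr_diff : forall i, 'M[S]_(gfr_rank i.+1, gfr_rank i);
  gfr_aug_homog : forall k, homogz (gfr_shift k) (gfr_aug k 0);
  gfr_diff_homog : forall i k l,
    homogz (gfr_shift k - gfr_shift l) (gfr_diff i k l);
  gfr_aug_onto : forall p,
    I p <-> exists v : 'rV[S]_(gfr_rank 0), p = (v *m gfr_aug) 0 0;
  gfr_exact0 : forall v : 'rV[S]_(gfr_rank 0),
    v *m gfr_aug = 0 <-> exists w, v = w *m gfr_diff 0;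
  gfr_exactS : forall i (v : 'rV[S]_(gfr_rank i.+1)),
    v *m gfr_diff i = 0 <-> exists w, v = w *m gfr_diff i.+1
}.

Section Tor.
Variables (I : S -> Prop) (F : graded_free_resolution I).

(* K = S / (x_1, ..., x_n), so tensoring F with K keeps the ranks and shifts and
   replaces every matrix entry by its constant coefficient. *)
Definition tensK_diff i : 'M[K]_(gfr_rank F i.+1, gfr_rank F i) :=
  map_mx (mcoeff 0%MM) (gfr_diff F i).

Definition tensK_degree i (j : int) (u : 'rV[K]_(gfr_rank F i)) : Prop :=
  forall k, gfr_shift (g := F) k != j -> u 0 k = 0.

Definition tensK_cycle i : 'rV[K]_(gfr_rank F i) -> Prop :=
  match i with
  | 0 => fun _ => True
  | i'.+1 => fun u => u *m tensK_diff i' = 0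
  end.

Definition tensK_boundary i (j : int) (u : 'rV[K]_(gfr_rank F i)) : Prop :=
  exists2 w, tensK_degree (i := i.+1) j w & u = w *m tensK_diff i.

Definition tensK_homology_neq0 i (j : int) : Prop :=
  exists u, [/\ tensK_degree (i := i) j u, tensK_cycle u
              & ~ tensK_boundary j u].

End Tor.

(* Tor_i^S(I, K)_j != 0. The module Tor does not depend on the resolution, and
   homogeneous ideals have resolutions of the above form because S is
   Noetherian. *)
Definition Tor_neq0 (I : S -> Prop) (i : nat) (j : int) : Prop :=
  exists F : graded_free_resolution I, tensK_homology_neq0 F i j.

Definition reg (I : S -> Prop) : int :=
  max_int (fun r => exists i j, Tor_neq0 I i j /\ r = j - i%:Z).

Definition linear_resolution (I : S -> Prop) : Prop :=
  exists k : nat, generated_in_degree I k /\ reg I = k%:Z.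

(* The subring K[Z]. *)
Definition in_subring (Z : {set 'I_n}) (q : S) : Prop :=
  forall m, m \in msupp q -> forall i, i \notin Z -> m i = 0%N.

Definition stanley_space (c : 'X_{1..n}) (Z : {set 'I_n}) (p : S) : Prop :=
  exists2 q, in_subring Z q & p = 'X_[c] * q.

Definition is_direct_sum (I : S -> Prop) r (V : 'I_r -> S -> Prop) : Prop :=
  (forall p, I p <-> exists2 q : 'I_r -> S,
      forall i, V i (q i) & p = \sum_i q i) /\
  (forall q : 'I_r -> S, (forall i, V i (q i)) -> \sum_i q i = 0 ->
      forall i, q i = 0).

Record stanley_decomposition (I : S -> Prop) := StanleyDecomposition {
  sd_size : nat;
  sd_exp : 'I_sd_size -> 'X_{1..n};
  sd_vars : 'I_sd_size -> {set 'I_n};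
  sd_mem : forall i, I 'X_[sd_exp i];
  sd_sum : is_direct_sum I (fun i => stanley_space (sd_exp i) (sd_vars i))
}.

Definition hreg_decomposition (I : S -> Prop)
    (D : stanley_decomposition I) : nat :=
  \max_(i < sd_size D) mdeg (sd_exp (s := D) i).

Definition hreg (I : S -> Prop) : nat :=
  min_nat (fun h => exists D : stanley_decomposition I,
    h = hreg_decomposition D).

End Ideals.

(* Main.v *)
From Stdlib Require Import Classical ClassicalEpsilon.
Require Import Defs.
From mathcomp Require Import all_boot all_order all_algebra.
From mathcomp Require Import mpoly ring zify.

(** Let r = reg I and let J be the truncation of I, the span of the monomials of I
of degree at least r. By a theorem of Eisenbud and Goto, J has a linear resolution
and regularity r ([truncation_at_reg]), so the hypothesis gives a Stanley
decomposition of J with all generators of degree at most r. The monomials of I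
outside J are finitely many and have degree less than r. Adding each of them as a
Stanley space of dimension one gives a decomposition of I without generators of degree
above r, hence hreg I <= r ([hreg_truncation]).

The resolution of J is controlled through the Koszul complex K(J). A chain of
homological degree p and internal degree j has its coefficients in J_(j-p). Hence
H_p(K(J))_j vanishes if j - p < r, because J starts in degree r. If j - p > r, then
K(I) and K(J) agree in internal degree j at the places p + 1, p and p - 1, so that the
homology of J there is that of I, which vanishes by definition of r
([koszul_truncation]). What remains is j - p = r; for p = 0 this says that J is
generated in degree r.

Regularity is defined through Tor, computed from an arbitrary graded free
resolution F. Two facts make the above argument valid. The homology of F (x) K is
Koszul homology ([tensK_koszul]): one shifts along the syzygy modules of F, because
the Koszul complex of a free module is acyclic in positive degrees ([koszul_shift]). And
a resolution exists ([monomial_resolution]): the Taylor resolution on a finite set of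
monomial generators, provided by Dickson's lemma ([dickson]). The ranks of its modules
being finite, the set of values j - i with Tor_i(I, K)_j nonzero is bounded, so that its
maximum exists ([reg_max]). In the same way the minimum defining hreg is attained
because Stanley decompositions exist ([exists_partition]).

Exactness of the Taylor complex and acyclicity of the Koszul complex are one
statement ([taylor_exact]), as the Koszul complex is the Taylor complex of the
variables. It holds since in a fixed multidegree b the Taylor complex is the augmented
chain complex of the simplex on the monomials that divide x^b, and a nonempty simplex
is contractible.

Koszul chains with coefficients in a free module are matrices with one row for each
set of variables. The Koszul differential acts on the left and the maps of a resolution
on the right, so that these operations commute is associativity of the product. *)

Set Implicit Arguments.
Unset Strict Implicit.
Unset Printing Implicit Defensive.

Import Order.TTheory GRing.Theory Num.Theory.
Local Open Scope ring_scope.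

(** * Extremal integers *)

Lemma ex_min_nat (Q : nat -> Prop) : (exists h, Q h) ->
  exists2 h, Q h & forall k, Q k -> (h <= k)%N.
Proof.
move=> [h Qh]; apply: NNPP => nm; suff H k : forall i, (i < k)%N -> ~ Q i.
  exact: (H h.+1 h).
elim: k => // k IH i; rewrite ltnS leq_eqVlt => /orP[/eqP->|]; last exact: IH.
move=> Qk; apply: nm; exists k => // l Ql; rewrite leqNgt; apply/negP=> lk.
exact: (IH l).
Qed.

(** A largest element is one whose distance to the bound is least. *)
Lemma ex_max_nat (Q : nat -> Prop) B : (exists h, Q h) ->
  (forall h, Q h -> (h <= B)%N) -> exists2 h, Q h & forall k, Q k -> (k <= h)%N.
Proof.
move=> [h Qh] QB.
have [|k [l Ql kl] kmin] := @ex_min_nat (fun k => exists2 l, Q l & k = (B - l)%N).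
  by exists (B - h)%N; exists h.
exists l => // i Qi; have := kmin _ (ex_intro2 _ _ i Qi erefl); rewrite kl.
by have := QB i Qi; have := QB l Ql; lia.
Qed.

(** Maxima of integers are unique, which turns [epsilon] into a computation. *)
Lemma max_intE (A : int -> Prop) r : A r -> (forall s, A s -> s <= r) -> max_int A = r.
Proof.
move=> Ar Amax; rewrite /max_int.
have [Ae emax] := epsilon_spec (inhabits 0)
  (fun r => A r /\ forall s, A s -> s <= r) (ex_intro _ r (conj Ar Amax)).
by apply/le_anti; rewrite Amax ?emax.
Qed.

(** * Coefficients of polynomials *)

Section Coefficients.
Variables (K : fieldType) (n : nat).
Local Notation S := {mpoly K[n]}.
Implicit Types (p : S) (c d : 'X_{1..n}).

Lemma mcoeff_mulX p d c :
  (p * 'X_[d])@_c = if (d <= c)%MM then p@_(c - d) else 0.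
Proof.
case: ifPn => dc; first by rewrite -[in LHS](submK dc) addmC mcoeffMX.
apply/eqP; rewrite mcoeff_eq0; apply: contra dc.
by rewrite (perm_mem (msuppMX p d)) => /mapP[e _ ->]; rewrite lem_addr.
Qed.

Lemma mcoeff_sum_neq0 (T : eqType) (s : seq T) (P : pred T) (F : T -> S) c :
  (\sum_(i <- s | P i) F i)@_c != 0 -> exists i, [/\ i \in s, P i & (F i)@_c != 0].
Proof.
move=> H; suff /hasP[i si /andP[Pi Fi]] : has (fun i => P i && ((F i)@_c != 0)) s.
  by exists i.
apply: contraR H => /hasPn H; rewrite raddf_sum big_seq_cond big1 //= => i /andP[/H].
by move=> + Pi; rewrite Pi negbK => /eqP.
Qed.

Definition mpart (Q : pred 'X_{1..n}) p : S :=
  \sum_(m <- msupp p | Q m) p@_m *: 'X_[m].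

Lemma mcoeff_mpart Q p m : (mpart Q p)@_m = if Q m then p@_m else 0.
Proof.
rewrite /mpart raddf_sum /=; case: ifPn => Qm.
  rewrite [in RHS](mpolyE p) raddf_sum /= big_mkcond /=; apply: eq_bigr => c _.
  rewrite !mcoeffZ mcoeffX; case: ifPn => // Qc; case: eqP => [cm|]; rewrite ?mulr0 //.
  by rewrite cm Qm in Qc.
rewrite big1 // => c Qc; rewrite mcoeffZ mcoeffX; case: eqP => [cm|]; rewrite ?mulr0 //.
by rewrite cm (negPf Qm) in Qc.
Qed.

End Coefficients.

(** * The chain complex of a simplex *)

Section Simplex.
Variables (R : comNzRingType) (s : nat).
Implicit Types (A B : {set 'I_s}) (f g : {set 'I_s} -> R).

Definition face_sign (k : 'I_s) A : R := (-1) ^+ #|[set l in A | (l < k)%N]|.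

Definition simplex_diff f B : R :=
  \sum_(k | k \notin B) face_sign k B * f (k |: B).

(** Joining with the vertex [k0]: the contraction of a simplex onto one of its
vertices. *)
Definition simplex_cone (k0 : 'I_s) f A : R :=
  if k0 \in A then face_sign k0 (A :\ k0) * f (A :\ k0) else 0.

Lemma face_signU k l A : l \notin A ->
  face_sign k (l |: A) = face_sign k A * (-1) ^+ (l < k)%N.
Proof.
move=> lA; rewrite /face_sign -exprD; congr (_ ^+ _).
case: (boolP (l < k)%N) => lk.
  rewrite addn1 -[RHS]add1n -[X in _ = (X + _)%N](cards1 l) -cardsUI.
  rewrite [X in _ = (_ + #|pred_of_set X|)%N](_ : _ = set0) ?cards0 ?addn0; last first.
    by apply/setP=> i; rewrite !inE; apply/negP=> /and3P[/eqP-> lA' _]; rewrite lA' in lA.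
  congr #|pred_of_set _|; apply/setP=> i; rewrite !inE andb_orl.
  by case: eqP => [->|]; rewrite ?lk.
rewrite addn0; congr #|pred_of_set _|; apply/setP=> i; rewrite !inE.
by case: eqP => [->|//]; rewrite (negPf lk) !andbF.
Qed.

Lemma face_sign_sqr k A : face_sign k A * face_sign k A = 1.
Proof. by rewrite /face_sign -expr2 sqrr_sign. Qed.

Lemma face_sign_anti k l A : k \notin A -> l \notin A -> k != l ->
  face_sign k (l |: A) * face_sign l A = - (face_sign l (k |: A) * face_sign k A).
Proof.
move=> kA lA kl; rewrite !face_signU // -[in LHS]mulrAC -[in RHS]mulrAC.
rewrite (mulrC (face_sign l A)) -mulrN; congr (_ * _).
by case: (ltngtP k l) => [||/val_inj/eqP]; rewrite ?expr0 ?expr1 ?opprK // (negPf kl).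
Qed.

Lemma eq_simplex_diff f g : f =1 g -> simplex_diff f =1 simplex_diff g.
Proof. by move=> fg B; apply: eq_bigr => k _; rewrite fg. Qed.

(** The two orders of removing a pair of vertices give opposite signs. Comparing the
two vertices splits the double sum into opposite halves, which cancel in every
characteristic. *)
Lemma simplex_diff_diff f B : simplex_diff (simplex_diff f) B = 0.
Proof.
pose a k l := face_sign k B * (face_sign l (k |: B) * f (l |: (k |: B))).
have E : simplex_diff (simplex_diff f) B =
    \sum_(k | k \notin B) \sum_(l | (l \notin B) && (l != k)) a k l.
  rewrite /simplex_diff; apply: eq_bigr => k kB; rewrite big_distrr /=.
  by apply: eq_bigl => l; rewrite !inE negb_or andbC.
have {}E : simplex_diff (simplex_diff f) B =
    \sum_(k | k \notin B) (\sum_(l | (l \notin B) && (l < k)%N) a k l +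
                           \sum_(l | (l \notin B) && (k < l)%N) a k l).
  rewrite E; apply: eq_bigr => k _; rewrite (bigID (fun l : 'I_s => (l < k)%N)) /=.
  congr (_ + _); apply: eq_bigl => l; rewrite -val_eqE /=;
    by case: (l \notin B) => //=; case: ltngtP.
rewrite E big_split /= [X in _ + X](_ : _ = - \sum_(k | k \notin B)
   \sum_(l | (l \notin B) && (l < k)%N) a k l) ?subrr //.
rewrite [LHS](exchange_big_dep (fun l => l \notin B)) /=; last by move=> k l _ /andP[].
rewrite -sumrN; apply: eq_bigr => k kB; rewrite -sumrN.
apply: eq_big => [l|l]; first by rewrite kB.
move=> /and3P[lB _ lk]; rewrite /a setUCA !mulrA; rewrite -mulNr; congr (_ * _).
rewrite mulrC [in RHS]mulrC; apply: face_sign_anti => //.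
by rewrite neq_ltn lk orbT.
Qed.

(** A face through [k0] is the join of [k0] with its opposite face, any other face
is the boundary component opposite to [k0] in its join; the remaining terms
cancel in pairs by [face_sign_anti]. *)
Lemma simplex_cone_homotopy k0 f B :
  simplex_diff (simplex_cone k0 f) B + simplex_cone k0 (simplex_diff f) B = f B.
Proof.
rewrite /simplex_cone; case: (boolP (k0 \in B)) => kB; last first.
  rewrite addr0 /simplex_diff (bigD1 k0) //= setU11 setU1K // mulrA.
  rewrite face_sign_sqr mul1r big1 ?addr0 // => k /andP[_ kk].
  by rewrite !inE eq_sym (negPf kk) (negPf kB) mulr0.
rewrite /simplex_diff [X in _ * X](bigD1 k0) /=; last by rewrite !inE eqxx.
rewrite setD1K // mulrDr mulrA face_sign_sqr mul1r addrCA -[RHS]addr0.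
congr (_ + _); rewrite big_distrr /=.
rewrite [X in _ + X](eq_bigl (fun k => k \notin B)); last first.
  by move=> k; rewrite !inE negb_and negbK; case: eqP => [->|] /=; rewrite ?kB ?andbT.
rewrite -big_split big1 //= => k nkB; rewrite !inE kB orbT.
have kk : k != k0 by apply: contraNneq nkB => ->.
have -> : (k |: B) :\ k0 = k |: (B :\ k0).
  by apply/setP=> i; rewrite !inE; case: (i =P k) => [->|//]; rewrite kk.
rewrite -[X in face_sign k X](setD1K kB) !mulrA -mulrDl.
rewrite -[X in X * face_sign k0 _]mulr1 -(face_sign_sqr k0 (B :\ k0)) mulrA.
rewrite face_sign_anti ?inE ?eqxx ?(negPf nkB) ?andbF //.
set a := face_sign k0 (k |: _); set b := face_sign k _; set c := face_sign k0 _.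
have -> : - (a * b) * c * a = - (c * b) * (a * a) by ring.
by rewrite face_sign_sqr mulr1 addNr mul0r.
Qed.

End Simplex.

(** * Exactness of the Taylor complex *)

Section Taylor.
Variables (K : fieldType) (n s : nat) (m : 'I_s -> 'X_{1..n}).
Local Notation S := {mpoly K[n]}.
Implicit Types (A B : {set 'I_s}) (v w : {set 'I_s} -> S) (b c : 'X_{1..n}).

Definition lcm_set A : 'X_{1..n} := [multinom \max_(k in A) m k i | i < n]%N.

Lemma lcm_setP A b : reflect (forall k, k \in A -> (m k <= b)%MM) (lcm_set A <= b)%MM.
Proof.
apply: (iffP mnm_lepP) => [H k kA|H i].
  apply/mnm_lepP=> i; apply: leq_trans (H i); rewrite mnmE.
  exact: (leq_bigmax_cond (F := fun k => m k i)).
rewrite mnmE; apply/bigmax_leqP=> k kA; exact: (mnm_lepP (H k kA)).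
Qed.

Lemma lcm_setS A B : A \subset B -> (lcm_set A <= lcm_set B)%MM.
Proof.
move=> /subsetP AB; apply/lcm_setP => k /AB kB.
by move/lcm_setP: (lepm_refl (lcm_set B)); apply.
Qed.

Lemma lcm_set0 : lcm_set set0 = 0%MM.
Proof. by apply/mnmP=> i; rewrite mnmE big_set0 mnm0E. Qed.

Lemma lcm_setU1 k A b : (lcm_set (k |: A) <= b)%MM = (m k <= b)%MM && (lcm_set A <= b)%MM.
Proof.
apply/lcm_setP/andP => [H|[kb /lcm_setP Ab] l].
  by split; [apply: H; rewrite setU11|apply/lcm_setP=> l lA; apply: H; rewrite setU1r].
by rewrite !inE => /orP[/eqP->|/Ab].
Qed.

(** The entry at ([A], [B]) of the differential of the Taylor complex of the
monomials with exponents [m]. At most one [k] contributes; the sum avoids choosing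
it. *)
Definition taylor_coef A B : S :=
  \sum_(k | (k \notin B) && (A == k |: B))
    face_sign K k B *: 'X_[lcm_set A - lcm_set B].

(** Chains of all homological degrees are handled at once, as polynomial-valued
functions on the subsets of the index set. *)
Definition taylor_diff v B : S := \sum_A v A * taylor_coef A B.

Lemma eq_taylor_diff v w : v =1 w -> taylor_diff v =1 taylor_diff w.
Proof. by move=> vw B; apply: eq_bigr => A _; rewrite vw. Qed.

Lemma taylor_coef_card A B : #|A| != #|B|.+1 -> taylor_coef A B = 0.
Proof.
move=> AB; rewrite /taylor_coef big1 // => k /andP[kB /eqP AE]; move: AB.
by rewrite AE cardsU1 kB add1n eqxx.
Qed.

Lemma taylor_diffE v B : taylor_diff v B =
  \sum_(k | k \notin B)
     face_sign K k B *: (v (k |: B) * 'X_[lcm_set (k |: B) - lcm_set B]).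
Proof.
rewrite /taylor_diff /taylor_coef.
under eq_bigr do rewrite big_distrr /=.
rewrite (exchange_big_dep (fun k => k \notin B)) /=; last by move=> A k _ /andP[].
apply: eq_bigr => k kB; rewrite (big_pred1 (k |: B)) ?scalerAr //.
by move=> A; rewrite kB.
Qed.

(** The strand of multidegree [b]: the basis element of the face [A] has multidegree
[lcm_set A], so the chain [v] has in multidegree [b] the coefficient of the monomial
with exponent [b - lcm_set A] in [v A]. *)
Definition mdcoef v b A : K :=
  if (lcm_set A <= b)%MM then (v A)@_(b - lcm_set A) else 0.

Lemma mdcoef_inj v w :
  (forall b, mdcoef v b =1 mdcoef w b) -> v =1 w.
Proof.
move=> E A; apply/mpolyP=> c; move: (E (c + lcm_set A)%MM A).
by rewrite /mdcoef lem_addl addmK.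
Qed.

Lemma mdcoef0 b A : mdcoef (fun=> 0) b A = 0.
Proof. by rewrite /mdcoef mcoeff0 if_same. Qed.

(** In a fixed multidegree the monomial factors of the Taylor differential
disappear: what is left is the chain complex of the simplex on the monomials that
divide. *)
Lemma mdcoef_diff v b B :
  mdcoef (taylor_diff v) b B = simplex_diff (mdcoef v b) B.
Proof.
rewrite /mdcoef /simplex_diff taylor_diffE.
case: ifPn => [Bb|nBb]; last first.
  rewrite big1 // => k kB; rewrite ifF ?mulr0 //; apply/negbTE.
  by apply: contra nBb; rewrite lcm_setU1 => /andP[].
rewrite raddf_sum; apply: eq_bigr => k kB /=; rewrite mcoeffZ; congr (_ * _).
rewrite mcoeff_mulX; have BkB := lcm_setS (subsetUr [set k] B).
have E : (lcm_set (k |: B) - lcm_set B <= b - lcm_set B)%MM = (lcm_set (k |: B) <= b)%MM.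
  apply/mnm_lepP/mnm_lepP => H i; move/(_ i): H; rewrite !mnmBE;
  by move/mnm_lepP: BkB => /(_ i); move/mnm_lepP: Bb => /(_ i); lia.
rewrite E; case: ifP => // kb; congr (_@_ _); apply/mnmP=> i; rewrite !mnmBE.
by move/mnm_lepP: BkB => /(_ i); lia.
Qed.

Lemma taylor_diff_diff v : taylor_diff (taylor_diff v) =1 fun=> 0.
Proof.
apply: mdcoef_inj => b A; rewrite mdcoef_diff (eq_simplex_diff (mdcoef_diff v b)).
by rewrite simplex_diff_diff mdcoef0.
Qed.

Lemma mdcoef_surj (f : 'X_{1..n} -> {set 'I_s} -> K) N :
  (forall b A, ~~ (lcm_set A <= b)%MM -> f b A = 0) ->
  (forall b A, (N <= mdeg b)%N -> f b A = 0) ->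
  exists v, forall b, mdcoef v b =1 f b.
Proof.
move=> f0 fN.
exists (fun A => \sum_(c : 'X_{1..n < N}) f (c + lcm_set A)%MM A *: 'X_[c]) => b A.
rewrite /mdcoef; case: ifPn => [Ab|/f0->//].
have [bN|Nb] := ltnP (mdeg (b - lcm_set A)) N.
  by rewrite (mcoeff_mpoly (fun c => f (c + lcm_set A)%MM A)) // submK.
rewrite fN; last exact: leq_trans Nb (mdegB _ _).
rewrite raddf_sum big1 //= => c _; rewrite mcoeffZ mcoeffX.
have := bmdeg c; case: eqP => [->|]; last by rewrite mulr0.
by rewrite ltnNge Nb.
Qed.

Lemma mdcoef_bounded v : exists N, forall b A, (N <= mdeg b)%N -> mdcoef v b A = 0.
Proof.
(* [msize] is the degree plus one. *)
exists (\max_A (msize (v A) + mdeg (lcm_set A)))%N => b A Nb.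
rewrite /mdcoef; case: ifP => // Ab; apply/eqP; rewrite mcoeff_eq0.
apply: msize_mdeg_ge; rewrite -(leq_add2r (mdeg (lcm_set A))) -mdegD submK //.
apply: leq_trans Nb.
exact: (leq_bigmax (F := fun A => msize (v A) + mdeg (lcm_set A))%N).
Qed.

(** In multidegree [b] the complex is that of the simplex on the [k] with
[m k <= b], which is contractible as soon as there is one such [k]. When there is
none, only the empty face has a nonzero component, and the condition on [v set0]
excludes it: in degree 0 the cycles that are boundaries are the elements of the
ideal generated by the monomials. *)
Lemma taylor_exact v : taylor_diff v =1 (fun=> 0) ->
  (forall c, c \in msupp (v set0) -> exists k, (m k <= c)%MM) ->
  exists w, v =1 taylor_diff w.
Proof.
move=> dv0 v0.
(* A preimage, strand by strand: the cone over some divisor of multidegree b. *)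
pose f b A := if [pick k | (m k <= b)%MM] is Some k0
              then simplex_cone k0 (mdcoef v b) A else 0.
have [N vN] := mdcoef_bounded v.
have f0 b A : ~~ (lcm_set A <= b)%MM -> f b A = 0.
  rewrite /f; case: pickP => // k0 kb; rewrite /simplex_cone; case: ifP => // kA.
  rewrite -{1}(setD1K kA) lcm_setU1 kb /= => /negPf Ab.
  by rewrite /mdcoef Ab mulr0.
have fN b A : (N <= mdeg b)%N -> f b A = 0.
  move=> Nb; rewrite /f; case: pickP => // k0 _; rewrite /simplex_cone.
  by rewrite vN // mulr0 if_same.
have [w wE] := mdcoef_surj f0 fN; exists w; apply: mdcoef_inj => b B.
rewrite mdcoef_diff (eq_simplex_diff (wE b)).
rewrite /f; case: pickP => [k0 kb|nb].
  rewrite -[LHS](simplex_cone_homotopy k0) -[RHS]addr0; congr (_ + _).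
  rewrite /simplex_cone -mdcoef_diff /mdcoef dv0 mcoeff0 if_same mulr0.
  by rewrite if_same.
rewrite /simplex_diff [RHS]big1; last by move=> k _; rewrite mulr0.
rewrite /mdcoef; case: ifP => // /lcm_setP Bb.
have B0 : B = set0.
  by apply/setP=> k; rewrite inE; apply/negP=> /Bb; rewrite nb.
apply/eqP; rewrite mcoeff_eq0 B0 lcm_set0 subm0; apply/negP=> /v0[k].
by rewrite nb.
Qed.

Lemma taylor_exact_card p v : taylor_diff v =1 (fun=> 0) ->
  (forall c, c \in msupp (v set0) -> exists k, (m k <= c)%MM) ->
  (forall A, #|A| != p -> v A = 0) ->
  exists2 w, v =1 taylor_diff w & forall A, #|A| != p.+1 -> w A = 0.
Proof.
move=> dv0 v0 vp; have [w wE] := taylor_exact dv0 v0.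
exists (fun A => if #|A| == p.+1 then w A else 0); last by move=> A /negPf->.
move=> B; have [Bp|Bp] := eqVneq #|B| p; last first.
  rewrite vp // /taylor_diff big1 // => A _; case: eqP => [Ap|]; last by rewrite mul0r.
  by rewrite taylor_coef_card ?mulr0 // Ap eqSS eq_sym.
rewrite wE; apply: eq_bigr => A _; case: eqP => // /eqP Ap.
by rewrite taylor_coef_card ?mulr0 // Bp.
Qed.

End Taylor.

(** * Homogeneous components *)

Section Homogeneous.
Variables (K : fieldType) (n : nat).
Local Notation S := {mpoly K[n]}.
Implicit Types (p q : S) (d e : int).

Definition hcomp d p : S := mpart (fun m => (mdeg m)%:Z == d) p.

Lemma mcoeff_hcomp d p m : (hcomp d p)@_m = if (mdeg m)%:Z == d then p@_m else 0.
Proof. exact: mcoeff_mpart. Qed.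

Lemma homogz_coef d p :
  homogz d p <-> forall m, (mdeg m)%:Z != d -> p@_m = 0.
Proof.
split=> H m; last by rewrite mcoeff_msupp => pm; apply/eqP; apply: contraNT pm => /H->.
by move=> md; apply/eqP; rewrite mcoeff_eq0; apply: contra md => /H->.
Qed.

Lemma homogz_hcomp d p : homogz d (hcomp d p).
Proof. by apply/homogz_coef => m /negPf md; rewrite mcoeff_hcomp md. Qed.

Lemma hcomp_id d p : homogz d p -> hcomp d p = p.
Proof.
move=> /homogz_coef pd; apply/mpolyP=> m; rewrite mcoeff_hcomp.
by case: ifPn => // /pd->.
Qed.

(** This compatibility is what lets every lifting below be chosen homogeneous. *)
Lemma hcompM d e p q : homogz e q -> hcomp d (p * q) = hcomp (d - e) p * q.
Proof.
move=> /homogz_coef qe; apply/mpolyP=> m; rewrite mcoeff_hcomp !mcoeffM.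
have E (k : 'X_{1..n < (mdeg m).+1, (mdeg m).+1}) : m == (k.1 + k.2)%MM ->
    (hcomp (d - e) p)@_k.1 * q@_k.2 =
    if (mdeg m)%:Z == d then p@_k.1 * q@_k.2 else 0.
  move=> /eqP mE; rewrite mcoeff_hcomp.
  have -> : ((mdeg m)%:Z == d) = ((mdeg k.1 + mdeg k.2)%N%:Z == d).
    by congr (Posz _ == _); rewrite -mdegD; congr mdeg.
  have [ke|/qe->] := eqVneq (mdeg k.2)%:Z e; last by rewrite !mulr0 if_same.
  rewrite -ke; have -> : ((mdeg k.1)%:Z == d - (mdeg k.2)%:Z) =
      ((mdeg k.1 + mdeg k.2)%N%:Z == d).
    by apply/eqP/eqP; lia.
  by case: ifP => //; rewrite mul0r.
by rewrite (eq_bigr _ E); case: ifP => // _; rewrite big1.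
Qed.

Lemma hcomp_sum d (I : Type) (r : seq I) (P : pred I) (F : I -> S) :
  hcomp d (\sum_(i <- r | P i) F i) = \sum_(i <- r | P i) hcomp d (F i).
Proof.
apply/mpolyP=> m; rewrite mcoeff_hcomp !(raddf_sum (mcoeff m)).
case: ifPn => md; first by apply: eq_bigr => i _; rewrite /= mcoeff_hcomp md.
by rewrite big1 // => i _; rewrite /= mcoeff_hcomp (negPf md).
Qed.

Lemma homogz_sum d (I : Type) (r : seq I) (P : pred I) (F : I -> S) :
  (forall i, P i -> homogz d (F i)) -> homogz d (\sum_(i <- r | P i) F i).
Proof.
move=> H; have -> : \sum_(i <- r | P i) F i = hcomp d (\sum_(i <- r | P i) F i).
  by rewrite hcomp_sum; apply: eq_bigr => i /H Fd; rewrite hcomp_id.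
exact: homogz_hcomp.
Qed.

Lemma homogzZX d c m : (mdeg m)%:Z = d -> homogz d (c *: 'X_[m] : S).
Proof.
move=> md; apply/homogz_coef => m' m'd; rewrite mcoeffZ mcoeffX.
by move: m'd; case: (m =P m') => [<-|]; rewrite ?mulr0 // md eqxx.
Qed.

(** The matrices of degree 0 between graded free modules whose bases have degrees
[a] and [b]. A row vector of degree [j] is the case of a constant [a]. *)
Definition homog_mx r t (a : 'I_r -> int) (b : 'I_t -> int) (M : 'M[S]_(r, t)) :=
  forall i j, homogz (a i - b j) (M i j).

Definition homog_part r t (a : 'I_r -> int) (b : 'I_t -> int) (M : 'M[S]_(r, t)) :=
  \matrix_(i, j) hcomp (a i - b j) (M i j).

Lemma homog_mx_part r t a b (M : 'M[S]_(r, t)) : homog_mx a b (homog_part a b M).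
Proof. by move=> i j; rewrite mxE; apply: homogz_hcomp. Qed.

Lemma homog_part_id r t a b (M : 'M[S]_(r, t)) : homog_mx a b M -> homog_part a b M = M.
Proof. by move=> H; apply/matrixP=> i j; rewrite mxE hcomp_id. Qed.

Lemma homog_part_mulr r t u a b c (M : 'M[S]_(r, t)) (N : 'M[S]_(t, u)) :
  homog_mx b c N -> homog_part a c (M *m N) = homog_part a b M *m N.
Proof.
move=> H; apply/matrixP=> i j; rewrite !mxE hcomp_sum; apply: eq_bigr => k _.
by rewrite !mxE (hcompM _ _ (H k j)); congr (hcomp _ _ * _); ring.
Qed.

Lemma homog_part_mull r t u a b c (M : 'M[S]_(r, t)) (N : 'M[S]_(t, u)) :
  homog_mx a b M -> homog_part a c (M *m N) = M *m homog_part b c N.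
Proof.
move=> H; apply/matrixP=> i j; rewrite !mxE hcomp_sum; apply: eq_bigr => k _.
by rewrite !mxE mulrC (hcompM _ _ (H i k)) mulrC; congr (_ * hcomp _ _); ring.
Qed.

Lemma homog_mx_mul r t u a b c (M : 'M[S]_(r, t)) (N : 'M[S]_(t, u)) :
  homog_mx a b M -> homog_mx b c N -> homog_mx a c (M *m N).
Proof.
move=> HM HN; rewrite -[M](homog_part_id HM) -(homog_part_mulr _ _ HN).
exact: homog_mx_part.
Qed.

Lemma homogz_taylor_coef s (m : 'I_s -> 'X_{1..n}) A B :
  homogz ((mdeg (lcm_set m A))%:Z - (mdeg (lcm_set m B))%:Z) (taylor_coef K m A B).
Proof.
apply: homogz_sum => k /andP[kB /eqP ->]; apply: homogzZX.
have /submK E := lcm_setS m (subsetUr [set k] B).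
by rewrite -{2}E mdegD; lia.
Qed.

End Homogeneous.

(** * The Koszul complex *)

Section Koszul.
Variables (K : fieldType) (n : nat).
Local Notation S := {mpoly K[n]}.
Local Notation N := #|{: {set 'I_n}}|.
Local Notation face := (@enum_val _ (mem {: {set 'I_n}})).
Local Notation X := (fun k : 'I_n => U_(k)%MM).

Lemma lcm_setX (A : {set 'I_n}) i : lcm_set X A i = (i \in A).
Proof.
rewrite mnmE; apply/eqP; rewrite eqn_leq; apply/andP; split.
  apply/bigmax_leqP => k kA; rewrite mnm1E; case: eqP => // <-.
  by rewrite kA.
case: (boolP (i \in A)) => // iA.
by apply: leq_trans (leq_bigmax_cond _ iA); rewrite mnm1E eqxx.
Qed.

Lemma mdeg_lcm_setX (A : {set 'I_n}) : mdeg (lcm_set X A) = #|A|.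
Proof.
rewrite mdegE (eq_bigr (fun i => nat_of_bool (i \in A))); last first.
  by move=> i _; apply: lcm_setX.
by rewrite -sum1_card [RHS]big_mkcond; apply: eq_bigr => i _; case: (_ \in _).
Qed.

(** The Koszul differential is the Taylor differential of the variables. A Koszul
chain with coefficients in the free module of rank [r] is an N x r matrix, with one
row for each set of variables: [koszul_mx] acts on it on the left, and maps of free
modules act on the right. *)
Definition koszul_mx : 'M[S]_N :=
  \matrix_(b, a) taylor_coef K X (face a) (face b).

(** The projection onto homological degree [p]. *)
Definition card_proj (p : nat) : 'M[S]_N := diag_mx (\row_(a < N) (#|face a| == p)%:R).

(** The degree that a coefficient has in a Koszul chain of internal degree [j]. *)
Definition kdeg (j : int) (a : 'I_N) : int := j - #|face a|%:Z.

Local Notation P := koszul_mx.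
Local Notation E := card_proj.

Lemma card_projE (p : nat) r (y : 'M[S]_(N, r)) a l :
  (E p *m y) a l = if #|face a| == p then y a l else 0.
Proof. by rewrite mul_diag_mx !mxE; case: eqP; rewrite ?mul1r ?mul0r. Qed.

Lemma card_proj_idem (p : nat) r (y : 'M[S]_(N, r)) : E p *m (E p *m y) = E p *m y.
Proof. by apply/matrixP=> a l; rewrite !card_projE; case: (#|_| == p). Qed.

Lemma card_proj_koszul p : E p *m P = P *m E p.+1.
Proof.
apply/matrixP=> b a; rewrite card_projE mul_mx_diag !mxE.
have [bp|bp] := eqVneq #|face b| p; have [ap|ap] := eqVneq #|face a| p.+1.
- by rewrite mulr1.
- by rewrite mulr0 taylor_coef_card // bp.
- by rewrite mulr1 taylor_coef_card // ap eqSS eq_sym.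
- by rewrite mulr0.
Qed.

Lemma card_proj_mulmx p r (y : 'M[S]_(N, r)) : E p *m (P *m y) = P *m (E p.+1 *m y).
Proof. by rewrite !mulmxA card_proj_koszul. Qed.

Lemma homog_koszul j : homog_mx (kdeg j) (kdeg j) P.
Proof.
move=> b a; rewrite mxE /kdeg; have := @homogz_taylor_coef K n n X (face a) (face b).
by rewrite !mdeg_lcm_setX; congr homogz; ring.
Qed.

Lemma homog_card_proj p j : homog_mx (kdeg j) (kdeg j) (E p).
Proof.
move=> b a; rewrite !mxE; case: (b =P a) => [->|_] /=; last first.
  by apply/homogz_coef => m _; rewrite mulr0n mcoeff0.
rewrite mulr1n subrr; case: (_ == p); apply/homogz_coef => m m0; rewrite ?mcoeff0 //.
by rewrite mcoeff1; move: m0; case: (m =P 0%MM) => // ->; rewrite mdeg0 eqxx.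
Qed.

Lemma koszul_mxE r (y : 'M[S]_(N, r)) b l :
  (P *m y) b l = taylor_diff X (fun A => y (enum_rank A) l) (face b).
Proof.
rewrite mxE /taylor_diff (reindex face) /=; last first.
  by apply: onW_bij; apply: enum_val_bij.
by apply: eq_bigr => a _; rewrite mxE enum_valK mulrC.
Qed.

Lemma koszul_koszul r (y : 'M[S]_(N, r)) : P *m (P *m y) = 0.
Proof.
apply/matrixP=> b l; rewrite koszul_mxE mxE.
rewrite -[RHS](taylor_diff_diff X (fun A => y (enum_rank A) l) (face b)).
by apply: eq_taylor_diff => A; rewrite koszul_mxE enum_rankK.
Qed.

Definition empty_face : 'I_N := enum_rank set0.

(** The last Koszul differential takes values in the ideal of the variables. *)
Lemma koszul_empty_face r (y : 'M[S]_(N, r)) l : ((P *m y) empty_face l)@_0 = 0.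
Proof.
rewrite koszul_mxE taylor_diffE raddf_sum big1 //= => k _.
rewrite mcoeffZ mcoeff_mulX ifF ?mulr0 //; apply/negP=> /mnm_lepP/(_ k).
by rewrite enum_rankK lcm_set0 subm0 lcm_setX mnm0E setU11.
Qed.

(** Acyclicity for coefficients in a free module, one column at a time: the
condition on the constant coefficients places the degree 0 part in the ideal of the
variables. *)
Lemma koszul_acyclic r (y : 'M[S]_(N, r)) : P *m y = 0 ->
  (forall l, (y empty_face l)@_0 = 0) -> exists w, y = P *m w.
Proof.
move=> Py y0.
have H l : exists w : {set 'I_n} -> S, (fun A => y (enum_rank A) l) =1 taylor_diff X w.
  apply: taylor_exact => [B|c cy].
    by rewrite -(enum_rankK B) -koszul_mxE Py mxE.
  have [k] : exists k, c k != 0%N.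
    apply/existsP; apply: contraLR cy; rewrite negb_exists => /forallP c0.
    rewrite -mcoeff_eq0; have -> : c = 0%MM.
      by apply/mnmP => k; move: (c0 k); rewrite negbK mnm0E => /eqP.
    by rewrite y0.
  by move=> ck; exists k; rewrite lep1mP.
have [w wE] := fin_all_exists H.
exists (\matrix_(a, l) w l (face a)); apply/matrixP=> b l.
rewrite koszul_mxE; have := wE l (face b); rewrite enum_valK => ->.
by apply: eq_taylor_diff => A; rewrite mxE enum_rankK.
Qed.

Lemma card_proj_empty_face p r (y : 'M[S]_(N, r)) l :
  E p.+1 *m y = y -> y empty_face l = 0.
Proof. by move=> <-; rewrite card_projE enum_rankK cards0. Qed.

Lemma koszul_cycle0 r (y : 'M[S]_(N, r)) : E 0 *m y = y -> P *m y = 0.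
Proof.
move=> <-; apply/matrixP=> b l; rewrite !mxE big1 // => a _; rewrite card_projE.
case: eqP => [a0|]; rewrite ?mulr0 // mxE taylor_coef_card ?mul0r //.
by rewrite a0.
Qed.

End Koszul.

(** * Dimension shifting *)

Section Shift.
Variables (K : fieldType) (n : nat).
Local Notation S := {mpoly K[n]}.
Local Notation N := #|{: {set 'I_n}}|.
Local Notation P := (koszul_mx K n).
Local Notation E := (card_proj K n).

Variables (g : nat -> nat) (sh : forall i, 'I_(g i) -> int).
Variable (D : forall i, 'M[S]_(g i.+1, g i)).
Hypothesis Dhomog : forall i, homog_mx (@sh i.+1) (@sh i) (D i).
Hypothesis Dexact : forall i (v : 'rV[S]_(g i.+1)),
  v *m D i = 0 <-> exists w, v = w *m D i.+1.

Lemma exact_mx i r (x : 'M[S]_(r, g i.+1)) :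
  x *m D i = 0 <-> exists w, x = w *m D i.+1.
Proof.
split=> [xD|[w ->]]; last first.
  apply/row_matrixP=> k; rewrite row0 !row_mul.
  by apply/Dexact; exists (row k w).
have H k : exists w, row k x = w *m D i.+1.
  by apply/Dexact; rewrite -row_mul xD row0.
have [w wE] := fin_all_exists H.
exists (\matrix_k w k); apply/row_matrixP=> k.
by rewrite row_mul rowK.
Qed.

(** Let Z_i be the image of [D i], a submodule of the free module G_i of rank [g i],
and let m be the ideal of the variables. For positive [p] the property says that
H_p(K(Z_i)) is nonzero in degree [j], since the boundaries in K(G_i) are its cycles.
For p = 0 it concerns the kernel of Z_i / m Z_i -> G_i / m G_i. Asking the cycle to be
a boundary in K(G_i), instead of asking that its differential vanish, makes the
dimension shift valid down to p = 0. *)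
Definition koszul_syz_neq0 (p i : nat) (j : int) : Prop :=
  exists z : 'M[S]_(N, g i),
    [/\ homog_mx (kdeg j) (@sh i) z, E p *m z = z, exists x, z = x *m D i,
        exists y, z = P *m y & ~ exists x, z = P *m (x *m D i)].

(** The connecting homomorphism of 0 -> Z_(i+1) -> G_(i+1) -> Z_i -> 0. A cycle over
Z_i is lifted to G_(i+1) and its differential has coefficients in Z_(i+1); backwards,
a cycle over Z_(i+1) is a boundary in K(G_(i+1)) of a chain that maps to a cycle over
Z_i. Both ways the classes correspond because K(G_(i+1)) is acyclic in positive
degrees. *)
Lemma koszul_shift p i j : koszul_syz_neq0 p.+1 i j <-> koszul_syz_neq0 p i.+1 j.
Proof.
split=> -[z [zj Ez [x0 zx0] [y0 zy0] nz]].
  pose x := E p.+1 *m homog_part (kdeg j) (@sh i.+1) x0.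
  have zx : z = x *m D i.
    by rewrite -mulmxA -(homog_part_mulr _ _ (@Dhomog i)) -zx0 homog_part_id.
  have xj : homog_mx (kdeg j) (@sh i.+1) x.
    by apply: homog_mx_mul; [apply: homog_card_proj|apply: homog_mx_part].
  have Ex : E p.+1 *m x = x by rewrite card_proj_idem.
  clearbody x; exists (P *m x); split.
  - exact: homog_mx_mul (@homog_koszul K n j) xj.
  - by rewrite card_proj_mulmx Ex.
  - by apply/exact_mx; rewrite -mulmxA -zx zy0 koszul_koszul.
  - by exists x.
  case=> x2 Px; apply: nz.
  (* If P x is a boundary over Z_(i+1), then x is a boundary modulo Z_(i+1). *)
  pose u := x - E p.+1 *m (x2 *m D i.+1).
  have Pu : P *m u = 0.
    by rewrite mulmxBr -card_proj_mulmx -Px card_proj_mulmx Ex subrr.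
  have [v uv] : exists v, u = P *m v.
    apply: koszul_acyclic => // l; rewrite (@card_proj_empty_face K n p) ?mcoeff0 //.
    by rewrite mulmxBr Ex card_proj_idem.
  exists v; rewrite mulmxA -uv mulmxBl -zx -[LHS]subr0; congr (_ - _).
  by rewrite mulmxA; apply/esym/exact_mx; exists (E p.+1 *m x2).
pose y := E p.+1 *m homog_part (kdeg j) (@sh i.+1) y0.
have zy : z = P *m y.
  rewrite -card_proj_mulmx.
  by rewrite -(homog_part_mull _ _ (@homog_koszul K n j)) -zy0 homog_part_id.
have yj : homog_mx (kdeg j) (@sh i.+1) y.
  by apply: homog_mx_mul; [apply: homog_card_proj|apply: homog_mx_part].
have Ey : E p.+1 *m y = y by rewrite card_proj_idem.
clearbody y; have EyD : E p.+1 *m (y *m D i) = y *m D i by rewrite mulmxA Ey.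
exists (y *m D i); split=> //.
- exact: homog_mx_mul yj (@Dhomog i).
- by exists y.
- apply: koszul_acyclic => [|l]; last by rewrite (card_proj_empty_face _ EyD) mcoeff0.
  by rewrite mulmxA -zy; apply/exact_mx; exists x0.
case=> v yv; apply: nz.
have [w wE] : exists w, y - P *m v = w *m D i.+1.
  by apply/exact_mx; rewrite mulmxBl yv mulmxA subrr.
by exists w; rewrite -wE mulmxBr koszul_koszul subr0.
Qed.

Lemma koszul_shift0 p j : koszul_syz_neq0 p 0 j <-> koszul_syz_neq0 0 p j.
Proof.
suff H i : koszul_syz_neq0 p i j <-> koszul_syz_neq0 0 (p + i) j by rewrite H addn0.
by elim: p i => // p IH i; rewrite koszul_shift IH addnS.
Qed.

Local Notation const := (map_mx (mcoeff 0%MM)).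
Local Notation e0 := (delta_mx (empty_face n) 0 : 'cV[S]_N).

(** Chains of homological degree 0 are row vectors, placed in the row of the empty
set. *)
Lemma e0_row r (x : 'M[S]_(N, r)) : E 0 *m x = x -> x = e0 *m row (empty_face n) x.
Proof.
move=> Ex; apply/matrixP=> a l; rewrite -{1}Ex card_projE mxE big_ord1 !mxE eqxx andbT.
rewrite cards_eq0 -(inj_eq enum_rank_inj) enum_valK.
by case: eqP => [->|]; rewrite ?mul1r ?mul0r.
Qed.

Lemma card_proj_e0 r (x : 'rV[S]_r) : E 0 *m (e0 *m x) = e0 *m x.
Proof.
rewrite mulmxA; congr (_ *m _); apply/matrixP=> a l; rewrite card_projE !mxE.
rewrite cards_eq0 -(inj_eq enum_rank_inj) enum_valK -/(empty_face n).
by case: (a == empty_face n).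
Qed.

Lemma row_e0 r (x : 'rV[S]_r) : row (empty_face n) (e0 *m x) = x.
Proof. by apply/rowP=> l; rewrite !mxE big_ord1 !mxE !eqxx mul1r. Qed.

Lemma mcoeff0_homog_neq0 d (p : S) : homogz d p -> p@_0 != 0 -> d = 0.
Proof. by move=> pd; rewrite -mcoeff_msupp => /pd <-; rewrite mdeg0. Qed.

(** Here Z_i is the image of [D i] as above. Exactness gives
G_(i+1) / Z_(i+1) = Z_i, hence the cokernel of [const (D i.+1)] is Z_i / m Z_i. An
element [u] of the former and a chain [z] of the latter correspond when [z] is the
image under [D i] of a vector with constant coefficients [u]. The predicates [Cu] and
[Cz] carry along a condition on cycles, which is different at the start of the
resolution and further on. *)
Lemma tensor_syz i (j : int)
    (Cu : 'rV[K]_(g i.+1) -> Prop) (Cz : 'M[S]_(N, g i) -> Prop) :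
  (forall x : 'rV[S]_(g i.+1), Cz (e0 *m x *m D i) <-> Cu (const x)) ->
  (exists u : 'rV[K]_(g i.+1), [/\ forall k, sh k != j -> u 0 k = 0, Cu u
               & ~ exists w, u = w *m const (D i.+1)]) <->
  (exists z : 'M[S]_(N, g i),
    [/\ homog_mx (kdeg j) (@sh i) z, E 0 *m z = z, exists x, z = x *m D i,
        Cz z & ~ exists x, z = P *m (x *m D i)]).
Proof.
move=> CzE; split=> [[u [uj Cuu nu]]|[z [zj Ez [x0 zx0] Czz nz]]].
  pose v : 'rV[S]_(g i.+1) := map_mx (@mpolyC n K) u.
  have cv : const v = u by apply/rowP=> l; rewrite !mxE mpolyCK.
  exists (e0 *m v *m D i); split; last 1 first.
  - case=> x; rewrite mulmxA => /eqP; rewrite -subr_eq0 -mulmxBl => /eqP/exact_mx[w wE].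
    apply: nu; exists (const (row (empty_face n) w)); rewrite -map_mxM -row_mul -wE.
    rewrite raddfB /= row_e0 map_mxB cv [X in _ - X](_ : _ = 0) ?subr0 //.
    by apply/rowP=> l; rewrite mxE [(row _ _) _ _]mxE [RHS]mxE; apply: koszul_empty_face.
  - apply: (homog_mx_mul (b := @sh i.+1) _ (@Dhomog i)) => a l; rewrite mxE big_ord1 !mxE.
    case: (a =P empty_face n) => [->|_]; last first.
      by rewrite mul0r; apply/homogz_coef => m; rewrite mcoeff0.
    rewrite eqxx mul1r; apply/homogz_coef => m md; rewrite mcoeffC.
    case: (m =P 0%MM) md => [->|]; last by rewrite mulr0.
    rewrite mulr1 /kdeg enum_rankK cards0 mdeg0 subr0 => jl; apply: uj.
    by apply: contraNneq jl => ->; rewrite subrr.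
  - by rewrite mulmxA card_proj_e0.
  - by exists (e0 *m v).
  - by apply/CzE; rewrite cv.
pose x := E 0 *m homog_part (kdeg j) (@sh i.+1) x0.
have zx : z = x *m D i.
  by rewrite -mulmxA -(homog_part_mulr _ _ (@Dhomog i)) -zx0 homog_part_id.
have xj : homog_mx (kdeg j) (@sh i.+1) x.
  by apply: homog_mx_mul; [apply: homog_card_proj|apply: homog_mx_part].
have Ex : E 0 *m x = x by rewrite card_proj_idem.
clearbody x; have xe := e0_row Ex.
exists (const (row (empty_face n) x)); split.
- move=> k; apply: contraNeq; rewrite !mxE => /(mcoeff0_homog_neq0 (xj _ _)).
  by rewrite /kdeg enum_rankK cards0 subr0 => /eqP; rewrite subr_eq0 eq_sym.
- by apply/CzE; rewrite -xe -zx.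
(* x and a lift of w D_(i+1) have the same constant coefficients, so that they
   differ by an element of m G_(i+1). *)
case=> w wE; apply: nz; pose x' := x - e0 *m map_mx (@mpolyC n K) w *m D i.+1.
have Ex' : E 0 *m x' = x' by rewrite mulmxBr Ex mulmxA card_proj_e0.
have [y yE] : exists y, x' = P *m y.
  apply: koszul_acyclic; first exact: koszul_cycle0.
  move=> l; transitivity (const (row (empty_face n) x') 0 l).
    by rewrite [RHS]mxE [(row _ _) _ _]mxE.
  rewrite raddfB /= row_mul row_e0.
  rewrite map_mxB map_mxM wE /= -map_mx_comp (eq_map_mx _ (@mpolyCK n K)) map_mx_id //.
  by rewrite subrr mxE.
exists y; rewrite mulmxA -yE mulmxBl -zx -[LHS]subr0; congr (_ - _).
by apply/esym/exact_mx; exists (e0 *m map_mx (@mpolyC n K) w).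
Qed.

End Shift.

(** * Tor and Koszul homology *)

Section TorKoszul.
Variables (K : fieldType) (n : nat).
Local Notation S := {mpoly K[n]}.
Local Notation N := #|{: {set 'I_n}}|.
Local Notation P := (koszul_mx K n).
Local Notation E := (card_proj K n).

(** The Koszul homology H_p(K(I)) is nonzero in internal degree [j]. *)
Definition koszul_neq0 (I : S -> Prop) (p : nat) (j : int) : Prop :=
  exists z : 'cV[S]_N,
    [/\ homog_mx (kdeg j) (fun=> 0) z, E p *m z = z, forall a, I (z a 0),
        P *m z = 0 & ~ exists2 w : 'cV[S]_N, (forall a, I (w a 0)) & z = P *m w].

Variables (I : S -> Prop) (F : graded_free_resolution I).

(** The resolution with the augmentation prepended as a map to the free module of rank
1, so that [I] is the image of the map number 0 and the syzygies of [I] are those of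
the other maps. *)
Definition aug_rank i := if i is i'.+1 then gfr_rank F i' else 1%N.

Definition aug_shift i : 'I_(aug_rank i) -> int :=
  match i with 0 => fun=> 0 | i'.+1 => gfr_shift (g := F) (i := i') end.

Definition aug_mx i : 'M[S]_(aug_rank i.+1, aug_rank i) :=
  match i with 0 => gfr_aug F | i'.+1 => gfr_diff F i' end.

Lemma aug_mx_homog i : homog_mx (@aug_shift i.+1) (@aug_shift i) (aug_mx i).
Proof.
case: i => [|i] k l; last exact: gfr_diff_homog.
by rewrite subr0 ord1; apply: gfr_aug_homog.
Qed.

Lemma aug_mx_exact i (v : 'rV[S]_(aug_rank i.+1)) :
  v *m aug_mx i = 0 <-> exists w, v = w *m aug_mx i.+1.
Proof. by case: i v => [|i] v; [apply: gfr_exact0 | apply: gfr_exactS]. Qed.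

Lemma in_ideal_mx (y : 'cV[S]_N) :
  (forall a, I (y a 0)) <-> exists x, y = x *m aug_mx 0.
Proof.
split=> [Iy|[x ->] a]; last first.
  by apply/(gfr_aug_onto F); exists (row a x); rewrite -row_mul [RHS]mxE.
have H a : exists v : 'rV_(gfr_rank F 0), y a 0 = (v *m gfr_aug F) 0 0.
  by apply/gfr_aug_onto.
have [v vE] := fin_all_exists H.
exists (\matrix_a v a); apply/row_matrixP=> a; apply/rowP=> k.
by rewrite row_mul rowK ord1 -vE mxE.
Qed.

Lemma koszul_neq0_aug p j : koszul_neq0 I p j <->
  exists z : 'cV[S]_N,
    [/\ homog_mx (kdeg j) (@aug_shift 0) z, E p *m z = z, exists x, z = x *m aug_mx 0,
        P *m z = 0 & ~ exists x, z = P *m (x *m aug_mx 0)].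
Proof.
split=> -[z [zj Ez Iz Pz nz]]; exists z; split=> //.
- exact/in_ideal_mx.
- case=> x zx; apply: nz; exists (x *m aug_mx 0); last exact: zx.
  by apply: (proj2 (in_ideal_mx _)); exists x.
- exact/in_ideal_mx.
- by case=> w /in_ideal_mx[x wx] zw; apply: nz; exists x; rewrite -wx.
Qed.

(** The entries of the tensored differential that link different degrees are 0, so a
preimage can be cut down to the degree of its image. *)
Lemma tensK_boundaryP i j (u : 'rV[K]_(gfr_rank F i)) : tensK_degree j u ->
  tensK_boundary j u <-> exists w, u = w *m tensK_diff F i.
Proof.
move=> uj; split=> [[w _ ->]|[w wE]]; first by exists w.
have dE k l : gfr_shift (g := F) (i := i.+1) k != gfr_shift (g := F) (i := i) l ->
    tensK_diff F i k l = 0.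
  move=> kl; rewrite mxE; apply/eqP; rewrite mcoeff_eq0; apply: contra kl.
  by move=> /gfr_diff_homog; rewrite mdeg0 => /esym/eqP; rewrite subr_eq0.
exists (\row_k if gfr_shift (g := F) (i := i.+1) k == j then w 0 k else 0).
  by move=> k /negPf kj; rewrite mxE kj.
apply/rowP=> l; rewrite !mxE.
have [lj|lj] := eqVneq (gfr_shift (g := F) l) j; last first.
  rewrite uj // big1 // => k _; rewrite mxE; case: eqP => [kj|]; last by rewrite mul0r.
  by rewrite dE ?mulr0 // kj eq_sym.
rewrite wE mxE; apply: eq_bigr => k _; rewrite mxE; case: eqP => // /eqP kj.
by rewrite dE ?mulr0 ?lj.
Qed.

(** The homology of F (x) K does not depend on the resolution F: it is Koszul
homology, by shifting from H_p(K(I)) down to the kernel of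
Z_p / m Z_p -> G_p / m G_p, which is the homology of F (x) K in degree p. *)
Theorem tensK_koszul p j : tensK_homology_neq0 F p j <-> koszul_neq0 I p j.
Proof.
have T : tensK_homology_neq0 F p j <->
    exists u : 'rV[K]_(gfr_rank F p), [/\ tensK_degree j u, tensK_cycle u &
      ~ exists w, u = w *m tensK_diff F p].
  by split=> -[u [uj uc nu]]; exists u; split=> // /(tensK_boundaryP uj).
rewrite T koszul_neq0_aug; case: p {T} => [|p].
  apply: (@tensor_syz _ _ _ _ _ aug_mx_homog aug_mx_exact 0 j
           (fun=> True) (fun z => P *m z = 0)) => x.
  split=> // _; apply: koszul_cycle0.
  by rewrite mulmxA card_proj_e0.
have H := @tensor_syz _ _ _ _ _ aug_mx_homog aug_mx_exact p.+1 j
  (fun u => u *m tensK_diff F p = 0) (fun z => exists y, z = P *m y).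
rewrite [X in X <-> _]H; last first.
  move=> x; rewrite /tensK_diff -map_mxM -mulmxA; split=> [[y yE]|x0].
    rewrite -[x *m _]row_e0 yE; apply/rowP=> l.
    by rewrite mxE [(row _ _) _ _]mxE [RHS]mxE; apply: koszul_empty_face.
  apply: koszul_acyclic; first by apply: koszul_cycle0; rewrite card_proj_e0.
  move=> l; transitivity ((map_mx (mcoeff 0%MM) (x *m gfr_diff F p)) 0 l).
    by rewrite [RHS]mxE -[x *m gfr_diff F p in RHS]row_e0 [(row _ _) _ _]mxE.
  by rewrite x0 mxE.
have := koszul_shift0 aug_mx_homog aug_mx_exact p.+1 j.
rewrite /koszul_syz_neq0 => <-; split=> -[z [zj Ez zx Pz nz]]; exists z; split=> //.
  by case: Pz => y ->; rewrite koszul_koszul.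
by apply: koszul_acyclic => // l; rewrite (card_proj_empty_face _ Ez) mcoeff0.
Qed.

End TorKoszul.

(** * Monomial ideals *)

Section MonomialIdeals.
Variables (K : fieldType) (n : nat).
Local Notation S := {mpoly K[n]}.

Definition upclosed (U : 'X_{1..n} -> Prop) := forall a b, U a -> (a <= b)%MM -> U b.

(** Monomial ideals are handled through the exponents of their monomials, so that
membership can be tested one coefficient at a time. *)
Definition monomials_of (I : S -> Prop) (U : 'X_{1..n} -> Prop) :=
  upclosed U /\ forall p, I p <-> forall c, c \in msupp p -> U c.

Lemma ideal_gen0 (G : S -> Prop) : ideal_gen G 0.
Proof. by exists [::]; rewrite big_nil. Qed.

Lemma ideal_genD (G : S -> Prop) p q :
  ideal_gen G p -> ideal_gen G q -> ideal_gen G (p + q).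
Proof.
move=> [s [sG ->]] [t [tG ->]]; exists (s ++ t); split; last by rewrite big_cat.
by move=> fg; rewrite mem_cat => /orP[/sG|/tG].
Qed.

Lemma ideal_genM (G : S -> Prop) f g : G g -> ideal_gen G (f * g).
Proof.
move=> Gg; exists [:: (f, g)]; split; last by rewrite big_seq1.
by move=> fg; rewrite inE => /eqP->.
Qed.

Lemma ideal_gen_mpoly (G : S -> Prop) p :
  (forall c, c \in msupp p -> exists a, G 'X_[a] /\ (a <= c)%MM) -> ideal_gen G p.
Proof.
move=> H; rewrite [p]mpolyE big_seq; apply: big_ind => [||c /H[a [Ga ac]]].
- exact: ideal_gen0.
- exact: ideal_genD.
- by rewrite -(submK ac) mpolyXD scalerAl; apply: ideal_genM.
Qed.

Lemma monomial_idealP I : monomial_ideal I -> exists U, monomials_of I U.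
Proof.
move=> [A IA]; exists (fun c => exists2 a, A a & (a <= c)%MM); split.
  by move=> a b [c Ac ca] ab; exists c => //; apply: lepm_trans ab.
move=> p; rewrite IA; split=> [[s [sG ->]] c|H].
  rewrite mcoeff_msupp => /mcoeff_sum_neq0[fg [/sG[a Aa ->] _]].
  by rewrite mcoeff_mulX; case: ifP => [ac _|]; [exists a|rewrite eqxx].
by apply: ideal_gen_mpoly => c /H[a Aa ac]; exists a; split=> //; exists a.
Qed.

Lemma monomials_ofX I U a : monomials_of I U -> I 'X_[a] <-> U a.
Proof.
move=> [_ IU]; rewrite IU; split=> [|Ua c]; first by apply; rewrite msuppX inE.
by rewrite msuppX inE => /eqP->.
Qed.

Lemma monomials_of_monomial I U : monomials_of I U -> monomial_ideal I.
Proof.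
move=> [Uup IU]; exists U => p; split=> [/IU H|[s [sG ->]]].
  by apply: ideal_gen_mpoly => c /H Uc; exists c; split; [exists c|apply: lepm_refl].
apply/IU => c; rewrite mcoeff_msupp => /mcoeff_sum_neq0[fg [/sG[a Ua ->] _]].
by rewrite mcoeff_mulX; case: ifP => [/(Uup _ _ Ua)|]; rewrite ?eqxx.
Qed.

(** Dickson's lemma, by induction on the number [t] of coordinates taken into account.
Elements that cover [U] in the coordinates below [t] cover in coordinate [t] as well
every exponent that is large there; the finitely many remaining values of coordinate
[t] are treated one by one. *)
Lemma dickson (U : 'X_{1..n} -> Prop) : exists l : seq 'X_{1..n},
  (forall b, b \in l -> U b) /\ forall a, U a -> exists2 b, b \in l & (b <= a)%MM.
Proof.
suff H t : (t <= n)%N -> forall V : 'X_{1..n} -> Prop, exists l : seq 'X_{1..n},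
    (forall b, b \in l -> V b) /\
    forall a, V a -> exists2 b, b \in l & forall i : 'I_n, (i < t)%N -> (b i <= a i)%N.
  have [l [lU Ul]] := H n (leqnn n) U; exists l; split=> // a /Ul[b bl ba].
  by exists b => //; apply/mnm_lepP=> i; apply: ba.
elim: t => [|t IH] tn V.
  case: (classic (exists a, V a)) => [[a Va]|nV].
    by exists [:: a]; split=> [b|b _]; [rewrite inE => /eqP->|exists a; rewrite ?inE].
  by exists [::]; split=> // a Va; case: nV; exists a.
pose i0 := Ordinal tn; have [l [lV Vl]] := IH (ltnW tn) V.
(* An exponent with value at least M in coordinate t is covered by l alone. *)
pose M := (\max_(b <- l) b i0)%N.
have [f fP] := fin_all_exists (fun c : 'I_M => IH (ltnW tn) (fun a => V a /\ a i0 = c)).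
exists (l ++ flatten [seq f c | c <- enum 'I_M]); split=> [b|a Va].
  rewrite mem_cat => /orP[/lV//|/flattenP[_ /mapP[c _ ->] bf]].
  by have [/(_ _ bf)[]] := fP c.
have le_t (b : 'X_{1..n}) : (b i0 <= a i0)%N ->
    (forall i : 'I_n, (i < t)%N -> (b i <= a i)%N) ->
    forall i : 'I_n, (i < t.+1)%N -> (b i <= a i)%N.
  move=> b0 bt i; rewrite ltnS leq_eqVlt => /orP[/eqP it|]; last exact: bt.
  by have -> : i = i0 by apply: val_inj.
have [aM|Ma] := ltnP (a i0) M.
  have [_ /(_ a)[//|b bf ba]] := fP (Ordinal aM).
  exists b; last first.
    by apply: le_t => //; have [/(_ _ bf)[_ ->]] := fP (Ordinal aM).
  rewrite mem_cat; apply/orP; right; apply/flattenP; exists (f (Ordinal aM)) => //.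
  by apply: map_f; rewrite mem_enum.
have [b bl ba] := Vl a Va; exists b; first by rewrite mem_cat bl.
apply: le_t => //; apply: leq_trans Ma.
by apply: (leq_bigmax_seq (F := fun b : 'X_{1..n} => b i0)).
Qed.

End MonomialIdeals.

(** * Existence of resolutions *)

Section TaylorResolution.
Variables (K : fieldType) (n s : nat) (m : 'I_s -> 'X_{1..n}).
Local Notation S := {mpoly K[n]}.

(** The faces with [c] vertices span the free module in homological degree [c] of the
Taylor complex, with homological degree 0 being the ring itself. *)
Definition taylor_rank (c : nat) := #|[pred A : {set 'I_s} | #|A| == c]|.
Local Notation face c k := (@enum_val _ [pred A : {set 'I_s} | #|A| == c] k).

Definition taylor_mx (c : nat) : 'M[S]_(taylor_rank c.+1, taylor_rank c) :=
  \matrix_(k, l) taylor_coef K m (face c.+1 k) (face c l).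

Definition taylor_aug : 'cV[S]_(taylor_rank 1) := \col_k taylor_coef K m (face 1 k) set0.

(** Extension by zero of a chain on the faces with [c] vertices to all faces, where
[taylor_exact_card] applies. *)
Definition face_fun (c : nat) (v : 'rV[S]_(taylor_rank c)) (A : {set 'I_s}) : S :=
  \sum_(k | face c k == A) v 0 k.

Lemma card_face (c : nat) k : #|face c k| = c.
Proof. by apply/eqP; have := enum_valP k; rewrite inE. Qed.

Lemma face_fun_face (c : nat) (v : 'rV[S]_(taylor_rank c)) k :
  face_fun v (face c k) = v 0 k.
Proof. by rewrite /face_fun (big_pred1 k) // => l; rewrite (inj_eq enum_val_inj). Qed.

Lemma face_fun_card (c : nat) (v : 'rV[S]_(taylor_rank c)) (A : {set 'I_s}) :
  #|A| != c -> face_fun v A = 0.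
Proof.
move=> Ac; rewrite /face_fun big1 // => k /eqP kA.
by rewrite -kA card_face eqxx in Ac.
Qed.

Lemma face_fun_row (c : nat) (w : {set 'I_s} -> S) :
  (forall A : {set 'I_s}, #|A| != c -> w A = 0) ->
  face_fun (\row_k w (face c k)) =1 w.
Proof.
move=> wc A; have [Ac|Ac] := eqVneq #|A| c; last by rewrite face_fun_card // wc.
have AP : A \in [pred A : {set 'I_s} | #|A| == c] by rewrite inE Ac.
by rewrite -(enum_rankK_in AP AP) face_fun_face mxE.
Qed.

Lemma taylor_diff_face (c : nat) (v : 'rV[S]_(taylor_rank c)) B :
  taylor_diff m (face_fun v) B = \sum_k v 0 k * taylor_coef K m (face c k) B.
Proof.
rewrite /taylor_diff /face_fun.
under eq_bigr do rewrite big_distrl /=.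
rewrite (exchange_big_dep xpredT) //=; apply: eq_bigr => k _.
by rewrite (big_pred1 (face c k)) // => A; rewrite eq_sym.
Qed.

Lemma face_fun_taylor (c : nat) (v : 'rV[S]_(taylor_rank c.+1)) :
  face_fun (v *m taylor_mx c) =1 taylor_diff m (face_fun v).
Proof.
move=> B; have [Bc|Bc] := eqVneq #|B| c; last first.
  rewrite face_fun_card // taylor_diff_face big1 // => k _.
  by rewrite taylor_coef_card ?mulr0 // card_face eqSS eq_sym.
have BP : B \in [pred A : {set 'I_s} | #|A| == c] by rewrite inE Bc.
rewrite -(enum_rankK_in BP BP) face_fun_face taylor_diff_face mxE.
by apply: eq_bigr => k _; rewrite mxE.
Qed.

Lemma taylor_augE v : (v *m taylor_aug) 0 0 = taylor_diff m (face_fun v) set0.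
Proof. by rewrite taylor_diff_face mxE; apply: eq_bigr => k _; rewrite mxE. Qed.

Lemma taylor_mx_exact (c : nat) (v : 'rV[S]_(taylor_rank c.+1)) :
  taylor_diff m (face_fun v) =1 (fun=> 0) <-> exists w, v = w *m taylor_mx c.+1.
Proof.
split=> [dv|[w ->] B]; last first.
  by rewrite (eq_taylor_diff _ (face_fun_taylor w)) taylor_diff_diff.
have v0 : face_fun v set0 = 0 by rewrite face_fun_card // cards0.
have [|A Ac|w vw wc] := taylor_exact_card dv _ (p := c.+1).
- by move=> b; rewrite v0 mcoeff_msupp mcoeff0 eqxx.
- exact: face_fun_card.
exists (\row_k w (face c.+2 k)); apply/rowP=> l.
rewrite -face_fun_face vw -[RHS]face_fun_face face_fun_taylor.
by apply: eq_taylor_diff => A; rewrite face_fun_row.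
Qed.

Lemma taylor_diff_face0 (c : nat) (v : 'rV[S]_(taylor_rank c.+2)) :
  v *m taylor_mx c.+1 = 0 <-> taylor_diff m (face_fun v) =1 (fun=> 0).
Proof.
split=> [v0 B|dv].
  by rewrite -face_fun_taylor v0 /face_fun big1 // => k _; rewrite mxE.
by apply/rowP=> l; rewrite -face_fun_face face_fun_taylor dv mxE.
Qed.

Lemma taylor_aug0 (v : 'rV[S]_(taylor_rank 1)) :
  v *m taylor_aug = 0 <-> taylor_diff m (face_fun v) =1 (fun=> 0).
Proof.
split=> [v0 B|dv]; last by apply/matrixP=> i j; rewrite !ord1 taylor_augE dv mxE.
have [->|B0] := eqVneq B set0; first by rewrite -taylor_augE v0 mxE.
rewrite taylor_diff_face big1 // => k _.
by rewrite taylor_coef_card ?mulr0 // card_face eqSS eq_sym cards_eq0.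
Qed.

Variable I : S -> Prop.
Hypothesis Im : forall p, I p <-> forall c, c \in msupp p -> exists k, (m k <= c)%MM.

Lemma taylor_aug_onto p :
  I p <-> exists v : 'rV[S]_(taylor_rank 1), p = (v *m taylor_aug) 0 0.
Proof.
rewrite Im; split=> [H|[v ->] c]; last first.
  rewrite mcoeff_msupp taylor_augE taylor_diffE => /mcoeff_sum_neq0[k [_ _]].
  rewrite mcoeffZ mcoeff_mulX lcm_set0 subm0 lcm_setU1.
  by case: ifP => [/andP[kc _] _|]; [exists k|rewrite mulr0 eqxx].
(* p is a chain of homological degree 0 and lies in the ideal, so it is a boundary. *)
pose v (A : {set 'I_s}) : S := if A == set0 then p else 0.
have dv : taylor_diff m v =1 (fun=> 0).
  move=> B; rewrite taylor_diffE big1 // => k kB; rewrite /v -cards_eq0 cardsU1 kB.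
  by case: eqP => [|_]; [lia|rewrite mul0r scaler0].
have [|A A0|w vw wc] := taylor_exact_card dv _ (p := 0).
- by move=> c; rewrite /v eqxx; apply: H.
- by rewrite /v -cards_eq0 (negPf A0).
exists (\row_(k < taylor_rank 1) w (face 1 k)); rewrite taylor_augE.
transitivity (v set0); first by rewrite /v eqxx.
by rewrite vw; apply: eq_taylor_diff => A; rewrite face_fun_row.
Qed.

Definition taylor_shift (c : nat) (k : 'I_(taylor_rank c)) : int :=
  (mdeg (lcm_set m (face c k)))%:Z.

Lemma taylor_resolution : inhabited (graded_free_resolution I).
Proof.
constructor; apply: (@GradedFreeResolution K n I (fun i => taylor_rank i.+1)
  (fun i => @taylor_shift i.+1) taylor_aug (fun i => taylor_mx i.+1)).
- move=> k; rewrite mxE -[taylor_shift k]subr0.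
  have := @homogz_taylor_coef K n s m (face 1 k) set0.
  by rewrite [X in _ - (mdeg X)%:Z]lcm_set0 mdeg0.
- by move=> i k l; rewrite mxE; apply: homogz_taylor_coef.
- exact: taylor_aug_onto.
- by move=> v; rewrite taylor_aug0 taylor_mx_exact.
- by move=> i v; rewrite taylor_diff_face0 taylor_mx_exact.
Qed.

End TaylorResolution.

Lemma monomial_resolution (K : fieldType) n (I : {mpoly K[n]} -> Prop) U :
  monomials_of I U -> inhabited (graded_free_resolution I).
Proof.
move=> [Uup IU]; have [l [lU Ul]] := dickson U.
apply: (@taylor_resolution _ _ _ (tnth (in_tuple l))) => p; rewrite IU.
split=> H c /H => [/Ul[b bl bc]|[k kc]].
  by have /tnthP[k bE] : b \in in_tuple l by []; exists k; rewrite -bE.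
by apply: Uup kc; apply: lU; apply: mem_tnth.
Qed.

(** * Koszul homology of a truncation *)

Section Truncation.
Variables (K : fieldType) (n : nat).
Local Notation S := {mpoly K[n]}.
Local Notation N := #|{: {set 'I_n}}|.
Local Notation P := (koszul_mx K n).
Local Notation E := (card_proj K n).
Implicit Types (I : S -> Prop) (U : 'X_{1..n} -> Prop).

Lemma Tor_koszul I U p j : monomials_of I U -> Tor_neq0 I p j <-> koszul_neq0 I p j.
Proof.
move=> IU; split=> [[F /tensK_koszul]//|H].
by have [F] := monomial_resolution IU; exists F; apply/tensK_koszul.
Qed.

(** A cycle that is not a boundary has a nonzero coefficient in the row of some set
with [p] elements, of degree [j - p]. *)
Lemma koszul_neq0_mem I U p j : monomials_of I U -> koszul_neq0 I p j ->
  (p <= n)%N /\ exists2 c, U c & (mdeg c)%:Z = j - p%:Z.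
Proof.
move=> [_ IU] [z [zj Ez Iz _ nz]].
have [a za] : exists a, z a 0 != 0.
  apply/existsP; apply: contra_notT nz; rewrite negb_exists => /forallP z0.
  exists 0.
    by move=> a; rewrite mxE; apply/IU => c; rewrite mcoeff_msupp mcoeff0 eqxx.
  by rewrite mulmx0; apply/colP=> a; rewrite mxE; apply/eqP; have := z0 a; rewrite negbK.
have ap : #|(enum_val a : {set 'I_n})| = p.
  by move: za; rewrite -Ez card_projE; case: ifP => [/eqP|]; rewrite ?eqxx.
split; first by rewrite -ap -[X in (_ <= X)%N]card_ord max_card.
have [c cz] : exists c, c \in msupp (z a 0).
  move: za; rewrite -msupp_eq0; case: (msupp _) => // c l _; exists c.
  by rewrite mem_head.
exists c; first by apply: (proj1 (IU _) (Iz a)).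
by rewrite (zj _ _ _ cz) subr0 /kdeg ap.
Qed.

(** Koszul homology in degree 0 is I / m I, so it is nonzero in the degree of a minimal
generator. *)
Lemma koszul_neq0_0 I U c : monomials_of I U -> U c ->
  (forall k, (U_(k) <= c)%MM -> ~ U (c - U_(k))%MM) -> koszul_neq0 I 0 (mdeg c).
Proof.
move=> IU Uc minc; have [Uup IUp] := IU.
have zE a : (delta_mx (empty_face n) 0 *m (('X_[c])%:M : 'M[S]_1)) a 0 =
            if a == empty_face n then 'X_[c] else 0.
  rewrite mxE big_ord1 !mxE eqxx andbT mulr1n.
  by case: eqP; rewrite ?mul1r ?mul0r.
exists (delta_mx (empty_face n) 0 *m ('X_[c])%:M); split.
- move=> a l; rewrite ord1 zE; case: eqP => [->|_] d; last first.
    by rewrite mcoeff_msupp mcoeff0 eqxx.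
  by rewrite msuppX inE => /eqP->; rewrite /kdeg enum_rankK cards0 !subr0.
- exact: card_proj_e0.
- move=> a; rewrite zE; apply/IUp => d; case: eqP => _; last first.
    by rewrite mcoeff_msupp mcoeff0 eqxx.
  by rewrite msuppX inE => /eqP->.
- by apply: koszul_cycle0; apply: card_proj_e0.
case=> w Iw /(congr1 (fun y : 'cV_N => (y (empty_face n) 0)@_c)).
rewrite zE eqxx mcoeffX eqxx => /esym wc.
have {wc} : ((P *m w) (empty_face n) 0)@_c != 0 by rewrite wc oner_eq0.
rewrite koszul_mxE taylor_diffE enum_rankK => /mcoeff_sum_neq0[k [_ _]].
rewrite mcoeffZ mcoeff_mulX setU0 lcm_set0 subm0.
have -> : lcm_set (fun k : 'I_n => U_(k)%MM) [set k] = U_(k)%MM.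
  by apply/mnmP=> i; rewrite lcm_setX inE mnm1E eq_sym.
case: ifP => kc; last by rewrite mulr0 eqxx.
rewrite mulf_eq0 negb_or -mcoeff_msupp => /andP[_ cw]; apply: (minc k kc).
exact: (proj1 (IUp _) (Iw _) _ cw).
Qed.

Definition truncation I (r : nat) : S -> Prop :=
  fun p => I p /\ forall c, c \in msupp p -> (r <= mdeg c)%N.

Lemma monomials_of_truncation I U r : monomials_of I U ->
  monomials_of (truncation I r) (fun c => U c /\ (r <= mdeg c)%N).
Proof.
move=> [Uup IU]; split=> [a b [Ua ra] ab|p].
  by split; [apply: Uup ab|rewrite -(submK ab) mdegD; lia].
split=> [[/IU H1 H2] c cp|H]; first by split; [apply: H1|apply: H2].
by split; [apply/IU|] => c /H[].
Qed.

(** A boundary in K(I) of a chain in homological degree [p.+1] and internal degree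
[j] has a preimage with coefficients of degree [j - p - 1]. As this is at least [r], the
preimage has its coefficients in the truncation. *)
Lemma koszul_truncation I U r p j : monomials_of I U -> r%:Z < j - p%:Z ->
  koszul_neq0 (truncation I r) p j -> koszul_neq0 I p j.
Proof.
move=> [Uup IU] rj [z [zj Ez Jz Pz nz]]; exists z; split=> //.
  by move=> a; case: (Jz a).
case=> w Iw zw; apply: nz; exists (E p.+1 *m homog_part (kdeg j) (fun=> 0) w).
  move=> a; rewrite card_projE mxE subr0 /kdeg.
  case: eqP => [->|_]; last first.
    by split; [apply/IU|] => c; rewrite mcoeff_msupp mcoeff0 eqxx.
  split; [apply/IU|] => c; rewrite mcoeff_msupp mcoeff_hcomp;
    case: ifP => [/eqP cE|_]; rewrite ?eqxx //.
    by rewrite -mcoeff_msupp; apply: (proj1 (IU _) (Iw a)).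
  by move=> _; lia.
rewrite -card_proj_mulmx -(homog_part_mull _ _ (@homog_koszul K n j)) -zw.
by rewrite homog_part_id.
Qed.

End Truncation.

(** * The regularity of a truncation *)

Section Regularity.
Variables (K : fieldType) (n : nat).
Local Notation S := {mpoly K[n]}.
Implicit Types (I : S -> Prop) (U : 'X_{1..n} -> Prop).

(** The values whose maximum is the regularity, with Koszul homology in place of
Tor. *)
Definition koszul_level I (r : int) :=
  exists i j, koszul_neq0 I i j /\ r = j - i%:Z.

Lemma regE I U r : monomials_of I U -> koszul_level I r ->
  (forall s, koszul_level I s -> s <= r) -> reg I = r.
Proof.
move=> IU [i [j [ij rE]]] rmax; apply: max_intE.
  by exists i, j; split=> //; apply/(Tor_koszul _ _ IU).
move=> s [i' [j' [/(Tor_koszul _ _ IU) H sE]]]; apply: rmax.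
by exists i', j'.
Qed.

Lemma koszul_shift_mem I (F : graded_free_resolution I) i j :
  koszul_neq0 I i j -> exists k, gfr_shift (g := F) (i := i) k = j.
Proof.
move=> /(tensK_koszul F)[u [uj _ nu]].
suff /existsP[k /eqP kj] : [exists k, gfr_shift (g := F) (i := i) k == j] by exists k.
apply: contra_notT nu; rewrite negb_exists => /forallP H.
exists 0; first by move=> k _; rewrite mxE.
by rewrite mul0mx; apply/rowP=> k; rewrite uj ?mxE.
Qed.

(** The values j - i are degrees of monomials of [I], hence natural numbers. They are
bounded: i is at most n, and j is one of the finitely many degrees of the generators of
the i-th module of a resolution. A monomial of least degree in [I] shows that there is
a value. *)
Lemma reg_max I U : monomials_of I U -> (exists c, U c) ->
  exists r : nat, [/\ reg I = r%:Z, koszul_level I r%:Z &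
                      forall s, koszul_level I s -> s <= r%:Z].
Proof.
move=> IU [c0 Uc0]; have [F] := monomial_resolution IU.
pose Q (h : nat) := koszul_level I h%:Z.
have levelE s : koszul_level I s -> exists2 h : nat, s = h%:Z & Q h.
  move=> sI; have [i [j [ij sE]]] := sI.
  have [_ [c _ cE]] := koszul_neq0_mem IU ij.
  by exists (mdeg c); rewrite /Q cE -sE.
have [_ [c Uc ->] cmin] : exists2 h, (exists2 c, U c & h = mdeg c) &
    forall k, (exists2 c, U c & k = mdeg c) -> (h <= k)%N.
  by apply: ex_min_nat; exists (mdeg c0), c0.
have Qc : Q (mdeg c).
  exists 0%N, (mdeg c)%:Z; split; last by rewrite subr0.
  apply: (koszul_neq0_0 IU) => // k kc Uk.
  have := cmin _ (ex_intro2 _ _ _ Uk erefl).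
  by rewrite -{1}(submK kc) mdegD mdeg1 addn1 ltnn.
pose B := (\max_(i < n.+1) \max_(k < gfr_rank F i) `|gfr_shift (g := F) k|)%N.
have QB h : Q h -> (h <= B)%N.
  move=> [i [j [ij hE]]]; have [k kj] := koszul_shift_mem F ij.
  have [iN _] := koszul_neq0_mem IU ij.
  have iN' : (i < n.+1)%N by [].
  apply: leq_trans (leq_bigmax (Ordinal iN')).
  apply: leq_trans (leq_bigmax (F := fun k => `|gfr_shift (g := F) (i := i) k|%N) k).
  by rewrite kj; lia.
have [r Qr rmax] := ex_max_nat (ex_intro _ _ Qc) QB; exists r.
have rmax' s : koszul_level I s -> s <= r%:Z by move=> /levelE[h -> /rmax].
by split=> //; apply: regE IU Qr rmax'.
Qed.

(** The theorem of Eisenbud and Goto for the truncation J at r = reg I. Values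
of J above r would be values of [I], and those below r are excluded by
degrees, so r is the only possible one. It occurs because a Koszul cycle of [I] that
realizes r has a coefficient of degree r, so that J starts in degree r. Vanishing of
Koszul homology in homological degree 0 and internal degree above r says that a
monomial of J of degree above r remains in J after division by some variable. *)
Lemma truncation_at_reg I U : monomials_of I U -> (exists c, U c) ->
  exists r : nat, [/\ reg I = r%:Z, reg (truncation I r) = r%:Z,
    generated_in_degree (truncation I r) r & exists2 c, U c & mdeg c = r].
Proof.
move=> IU U0; have [r [rE rI rmax]] := reg_max IU U0.
have JU := monomials_of_truncation r IU; set J := truncation I r in JU *.
have Jle s : koszul_level J s -> s <= r%:Z.
  move=> [i [j [ij sE]]]; rewrite leNgt; apply/negP=> rs.
  have : s <= r%:Z; last by rewrite leNgt rs.
  apply: rmax; exists i, j; split=> //; apply: (koszul_truncation IU) ij.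
  by rewrite -sE.
have [c Uc cr] : exists2 c, U c & mdeg c = r.
  have [i [j [ij rij]]] := rI; have [_ [c Uc cE]] := koszul_neq0_mem IU ij.
  by exists c => //; apply/eqP; rewrite -eqz_nat cE rij.
exists r; split=> //; last by exists c.
  apply: (regE JU) => //; exists 0%N, r%:Z; split; last by rewrite subr0.
  rewrite -cr; apply: (koszul_neq0_0 JU) => [|k kc [_]]; first by rewrite cr.
  by rewrite -cr -{1}(submK kc) mdegD mdeg1 addn1 ltnn.
have [Jup JUp] := JU.
have step d a : (U a /\ (r <= mdeg a)%N) -> mdeg a = (d + r)%N ->
    exists b, [/\ U b, mdeg b = r & (b <= a)%MM].
  elim: d a => [|d IH] a Ua ad.
    by exists a; split=> //; [case: Ua|exact: lepm_refl].
  have [k [ka Uk]] : exists k, (U_(k) <= a)%MM /\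
      (U (a - U_(k))%MM /\ (r <= mdeg (a - U_(k)))%N).
    apply: NNPP => nk.
    have : koszul_level J (mdeg a).
      exists 0%N, (mdeg a)%:Z; split; last by rewrite subr0.
      by apply: (koszul_neq0_0 JU) => // k ka Uk; apply: nk; exists k.
    by move=> /Jle; rewrite ad; lia.
  have [|b [Ub br ba]] := IH _ Uk.
    by move: ad; rewrite -{1}(submK ka) mdegD mdeg1; lia.
  by exists b; split=> //; apply: lepm_trans ba (lem_subr _ _).
move=> p; split=> [/JUp Jp|[s [sG ->]]].
  apply: ideal_gen_mpoly => a /Jp Ua.
  have [|b [Ub br ba]] := step (mdeg a - r)%N _ Ua; first by case: Ua; lia.
  exists b; split=> //; split; last by rewrite dhomogX; apply/eqP.
  by apply/(monomials_ofX _ JU); rewrite br.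
apply/JUp => a; rewrite mcoeff_msupp => /mcoeff_sum_neq0[[f g] [/sG[/= /JUp Jg _] _]].
rewrite -mcoeff_msupp => /msuppM_le/allpairsP[[b e] /= [_ eg ->]].
by apply: Jup (Jg e eg) _; apply: lem_addl.
Qed.

End Regularity.

(** * Stanley decompositions *)

Section Stanley.
Variables (K : fieldType) (n : nat).
Local Notation S := {mpoly K[n]}.
Implicit Types (I : S -> Prop) (U : 'X_{1..n} -> Prop).

(** The monomials of the Stanley space with generator [c] and variables [Z]. *)
Definition in_cell (c : 'X_{1..n}) (Z : {set 'I_n}) (a : 'X_{1..n}) : bool :=
  (c <= a)%MM && [forall i, (i \notin Z) ==> (a i == c i)].

Lemma in_cellP c (Z : {set 'I_n}) a :
  reflect ((c <= a)%MM /\ forall i, i \notin Z -> a i = c i) (in_cell c Z a).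
Proof.
apply: (iffP andP) => -[ca H]; split=> //.
  by move=> i iZ; move/forallP/(_ i): H; rewrite iZ => /eqP.
by apply/forallP=> i; apply/implyP=> /H/eqP.
Qed.

Lemma stanley_spaceP c (Z : {set 'I_n}) (p : S) :
  stanley_space c Z p <-> forall a, a \in msupp p -> in_cell c Z a.
Proof.
split=> [[q qZ ->] a|H].
  rewrite mulrC (perm_mem (msuppMX q c)) => /mapP[e eq ->]; apply/in_cellP.
  by split=> [|i iZ]; [apply: lem_addr|rewrite mnmDE (qZ _ eq _ iZ) addn0].
exists (\sum_(a <- msupp p) p@_a *: 'X_[a - c]).
  move=> e; rewrite mcoeff_msupp => /mcoeff_sum_neq0[a [/H/in_cellP[ca aZ] _]].
  rewrite mcoeffZ mcoeffX; case: ((a - c)%MM =P e) => [<- _ i iZ|]; last first.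
    by rewrite mulr0 eqxx.
  by rewrite mnmBE aZ // subnn.
rewrite big_distrr /= {1}[p]mpolyE; apply: eq_big_seq => a /H/in_cellP[ca _].
by rewrite -scalerAr -mpolyXD addmC submK.
Qed.

(** Stanley spaces and monomial ideals are spanned by monomials, so a Stanley
decomposition amounts to a partition of the monomials of the ideal into cells. *)
Definition stanley_partition U r (c : 'I_r -> 'X_{1..n}) (Z : 'I_r -> {set 'I_n}) :=
  [/\ forall i a, in_cell (c i) (Z i) a -> U a,
      forall a, U a -> exists i, in_cell (c i) (Z i) a &
      forall i j a, in_cell (c i) (Z i) a -> in_cell (c j) (Z j) a -> i = j].

Lemma in_cell_refl c (Z : {set 'I_n}) : in_cell c Z c.
Proof. by apply/in_cellP; split=> //; apply: lepm_refl. Qed.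

Lemma partition_direct_sum I U r (c : 'I_r -> 'X_{1..n}) Z :
  monomials_of I U -> stanley_partition U c Z ->
  is_direct_sum I (fun i => stanley_space (c i) (Z i)).
Proof.
move=> [Uup IU] [cU Uc cinj]; split=> [p|q qV q0 i].
  split=> [/IU pU|[q qV ->]]; last first.
    apply/IU => a; rewrite mcoeff_msupp => /mcoeff_sum_neq0[i [_ _]].
    by rewrite -mcoeff_msupp => ai; apply: (cU i); move/stanley_spaceP: (qV i); apply.
  exists (fun i => mpart (in_cell (c i) (Z i)) p).
    move=> i; apply/stanley_spaceP => a; rewrite mcoeff_msupp mcoeff_mpart.
    by case: ifP => //; rewrite eqxx.
  apply/mpolyP=> a; rewrite raddf_sum /=.
  have [ap|ap] := boolP (a \in msupp p).
    have [i ia] := Uc a (pU a ap).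
    rewrite (bigD1 i) //= mcoeff_mpart ia big1 ?addr0 // => j ji.
    by rewrite mcoeff_mpart; case: ifP => // ja; rewrite (cinj _ _ _ ia ja) eqxx in ji.
  rewrite (memN_msupp_eq0 ap) big1 // => i _.
  by rewrite mcoeff_mpart (memN_msupp_eq0 ap) if_same.
apply/mpolyP=> a; rewrite mcoeff0; apply/eqP; rewrite mcoeff_eq0; apply/negP=> aq.
have cell j : a \in msupp (q j) -> in_cell (c j) (Z j) a.
  by move: a {aq}; apply/stanley_spaceP.
have := congr1 (mcoeff a) q0.
rewrite raddf_sum mcoeff0 (bigD1 i) //= big1 ?addr0; last first.
  move=> j ji; apply: memN_msupp_eq0; apply: contra ji => /cell ja.
  by rewrite (cinj _ _ _ ja (cell _ aq)).
by move/eqP; rewrite mcoeff_eq0 aq.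
Qed.

Lemma direct_sum_partition I U r (c : 'I_r -> 'X_{1..n}) Z :
  monomials_of I U -> is_direct_sum I (fun i => stanley_space (c i) (Z i)) ->
  stanley_partition U c Z.
Proof.
move=> IU [Isum Iuniq].
have V0 i : stanley_space (c i) (Z i) (0 : S).
  by apply/stanley_spaceP => a; rewrite mcoeff_msupp mcoeff0 eqxx.
have VX i (p : S) a : in_cell (c i) (Z i) a -> p = 'X_[a] \/ p = - 'X_[a] ->
    stanley_space (c i) (Z i) p.
  move=> ia pE; apply/stanley_spaceP => b bp; suff -> : b = a by [].
  by case: pE bp => ->; rewrite ?(perm_mem (msuppN _)) msuppX inE => /eqP.
split=> [i a ia|a Ua|i j a ia ja].
- apply/(monomials_ofX a IU)/Isum; exists (fun j => if j == i then 'X_[a] else 0).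
    by move=> j; case: eqP => [->|_]; [apply: VX ia _; left|apply: V0].
  by rewrite (bigD1 i) //= eqxx big1 ?addr0 // => j /negPf->.
- have /Isum[q qV aE] : I 'X_[a] by apply/(monomials_ofX a IU).
  have : (\sum_i q i)@_a != 0 by rewrite -aE mcoeffX eqxx oner_eq0.
  move=> /mcoeff_sum_neq0[i [_ _]]; rewrite -mcoeff_msupp => ai.
  by exists i; move/stanley_spaceP: (qV i); apply.
apply/eqP; apply: contraT => ij.
pose q k : S := if k == i then 'X_[a] else if k == j then - 'X_[a] else 0.
have : q i = 0.
  apply: Iuniq => [k|].
    rewrite /q; case: eqP => [->|_]; first by apply: VX ia _; left.
    by case: eqP => [->|_]; [apply: VX ja _; right|apply: V0].
  rewrite (bigD1 i) //= (bigD1 j) 1?eq_sym //= /q eqxx eq_sym (negPf ij) eqxx.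
  by rewrite big1 ?addr0 ?subrr // => k /andP[/negPf-> /negPf->].
rewrite /q eqxx => /(congr1 (mcoeff a)); rewrite mcoeffX mcoeff0 eqxx => /eqP.
by rewrite oner_eq0.
Qed.

Lemma stanley_of_partition I U r (c : 'I_r -> 'X_{1..n}) Z :
  monomials_of I U -> stanley_partition U c Z ->
  exists D : stanley_decomposition I, hreg_decomposition D = (\max_(i < r) mdeg (c i))%N.
Proof.
move=> IU UP; have cI i : I 'X_[c i].
  apply/(monomials_ofX _ IU); case: UP => /(_ i (c i)) H _ _.
  exact: H (in_cell_refl _ _).
by exists (StanleyDecomposition cI (partition_direct_sum IU UP)).
Qed.

Lemma upclosed_decidable U : upclosed U ->
  exists l : seq 'X_{1..n}, forall a, U a <-> has (fun b => (b <= a)%MM) l.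
Proof.
move=> Uup; have [l [lU Ul]] := dickson U; exists l => a.
split=> [/Ul[b bl ba]|/hasP[b /lU Ub ba]]; last exact: Uup ba.
by apply/hasP; exists b.
Qed.

(** Let [M] bound the exponents of a finite set of generators. Whether [a] lies in [U]
only depends on the truncated exponent min(a, M), and the exponents with a given
truncation [c] form a cell, whose free variables are those where [c] equals [M]. *)
Lemma exists_partition U : upclosed U ->
  exists r (c : 'I_r -> 'X_{1..n}) Z, stanley_partition U c Z.
Proof.
move=> Uup; have [l Ul] := upclosed_decidable Uup.
pose M := (\max_(b <- l) \max_(i < n) b i)%N.
have lM b i : b \in l -> (b i <= M)%N.
  move=> bl; apply: leq_trans (leq_bigmax_seq
    (F := fun b : 'X_{1..n} => \max_(i < n) b i)%N _ bl isT).
  exact: (leq_bigmax (F := fun i => b i)).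
pose mon (t : {ffun 'I_n -> 'I_M.+1}) : 'X_{1..n} := [multinom nat_of_ord (t i) | i < n].
pose A := [set t | has (fun b => (b <= mon t)%MM) l].
pose Z (t : {ffun 'I_n -> 'I_M.+1}) := [set i | t i == M :> nat].
have cellE t a : in_cell (mon t) (Z t) a <-> forall i, t i = minn (a i) M :> nat.
  split=> [/in_cellP[/mnm_lepP ta tZ] i|tE].
    have := ta i; have := tZ i; rewrite inE mnmE; have := ltn_ord (t i).
    by case: eqP => [->|tM] /= => [_ _|]; [lia|move=> ? /(_ isT) ->; lia].
  apply/in_cellP; split; first by apply/mnm_lepP=> i; rewrite mnmE tE geq_minl.
  by move=> i; rewrite inE mnmE tE; lia.
exists #|A|, (fun k => mon (enum_val k)), (fun k => Z (enum_val k)); split.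
- move=> k a /in_cellP[ka _]; apply: Uup ka; apply/Ul.
  by have := enum_valP k; rewrite inE.
- move=> a /Ul/hasP[b bl /mnm_lepP ba].
  pose t : {ffun 'I_n -> 'I_M.+1} := [ffun i => inord (minn (a i) M)].
  have tE i : t i = minn (a i) M :> nat by rewrite ffunE inordK // ltnS geq_minr.
  have tA : t \in A.
    rewrite inE; apply/hasP; exists b => //; apply/mnm_lepP=> i.
    by rewrite mnmE tE leq_min ba lM.
  by exists (enum_rank_in tA t); rewrite enum_rankK_in //; apply/cellE.
move=> j k a /cellE ja /cellE ka; apply: enum_val_inj; apply/ffunP=> i.
by apply: val_inj; rewrite /= ja ka.
Qed.

(** Each of the finitely many monomials of degree less than [r] becomes a cell of its
own. *)
Lemma extend_partition U r s (c : 'I_s -> 'X_{1..n}) Z : upclosed U ->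
  stanley_partition (fun a => U a /\ (r <= mdeg a)%N) c Z ->
  exists t (c' : 'I_t -> 'X_{1..n}) Z', stanley_partition U c' Z' /\
    (\max_(i < t) mdeg (c' i) <= maxn (\max_(i < s) mdeg (c i)) r)%N.
Proof.
move=> Uup [cU Uc cinj]; have [l Ul] := upclosed_decidable Uup.
pose A := [set b : 'X_{1..n < r} | has (fun a => (a <= val b)%MM) l].
pose c' (i : 'I_(s + #|A|)) :=
  match split i with inl k => c k | inr k => val (enum_val k) end.
pose Z' (i : 'I_(s + #|A|)) :=
  match split i with inl k => Z k | inr k => set0 end.
have cell0 b a : in_cell b set0 a -> a = b.
  by move=> /in_cellP[_ H]; apply/mnmP=> i; apply: H; rewrite inE.
exists (s + #|A|)%N, c', Z'; split; last first.
  apply/bigmax_leqP=> i _; rewrite /c'; case: (split i) => k.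
    by rewrite leq_max (leq_bigmax (F := fun k => mdeg (c k))).
  by rewrite leq_max orbC ltnW ?bmdeg.
split=> [i a|a Ua|i j a].
- rewrite /c' /Z'; case: (split i) => k; first by move=> /cU[].
  by move=> /cell0->; apply/Ul; have := enum_valP k; rewrite inE.
- have [ra|ar] := leqP r (mdeg a).
    have [k ka] := Uc a (conj Ua ra); exists (lshift _ k).
    by rewrite /c' /Z' -[lshift _ k]/(unsplit (inl k)) unsplitK.
  have aA : BMultinom ar \in A by rewrite inE; apply/Ul.
  exists (rshift s (enum_rank_in aA (BMultinom ar))).
  rewrite /c' /Z' -[rshift s _]/(unsplit (inr _)) unsplitK enum_rankK_in //.
  exact: in_cell_refl.
rewrite /c' /Z' => ia ja; rewrite -[i]splitK -[j]splitK; congr unsplit.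
case: (split i) ia => k ka; case: (split j) ja => k' ka'.
- by rewrite (cinj _ _ _ ka ka').
- by have [_] := cU _ _ ka; rewrite (cell0 _ _ ka') leqNgt bmdeg.
- by have [_] := cU _ _ ka'; rewrite (cell0 _ _ ka) leqNgt bmdeg.
congr inr; apply: enum_val_inj; apply: val_inj.
by rewrite /= -(cell0 _ _ ka) -(cell0 _ _ ka').
Qed.

(** The minimum that defines [hreg] is attained once a decomposition exists. *)
Lemma hreg_min I : inhabited (stanley_decomposition I) ->
  (exists D : stanley_decomposition I, hreg I = hreg_decomposition D) /\
  forall D : stanley_decomposition I, (hreg I <= hreg_decomposition D)%N.
Proof.
move=> [D0]; pose Q h := exists D : stanley_decomposition I, h = hreg_decomposition D.
have [|h Qh hmin] := @ex_min_nat Q; first by exists (hreg_decomposition D0), D0.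
have [Qe emin] := epsilon_spec (inhabits 0%N)
  (fun h => Q h /\ forall s, Q s -> (h <= s)%N) (ex_intro _ h (conj Qh hmin)).
by split=> [|D]; [exact: Qe|apply: emin; exists D].
Qed.

Lemma hreg_truncation I U r : monomials_of I U ->
  (hreg (truncation I r) <= r)%N -> (hreg I <= r)%N.
Proof.
move=> IU; have [Uup _] := IU; have JU := monomials_of_truncation r IU.
have [s [c [Z cP]]] := exists_partition (proj1 JU).
have [D _] := stanley_of_partition JU cP.
have [[DJ ->] _] := hreg_min (inhabits D).
have [t [c' [Z' [cP' c'r]]]] :=
  extend_partition Uup (direct_sum_partition JU (sd_sum DJ)).
have [D' D'E] := stanley_of_partition IU cP'.
have [_ /(_ D') hD'] := hreg_min (inhabits D').
move=> DJr; apply: leq_trans hD' _; rewrite D'E; apply: leq_trans c'r _.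
by rewrite geq_max DJr leqnn.
Qed.

End Stanley.

(** * From linear resolutions to all monomial ideals *)

Theorem corollary2p6 (K : fieldType) (n : nat) :
  (forall I : {mpoly K[n]} -> Prop,
      monomial_ideal I -> nonzero_ideal I -> linear_resolution I ->
      (hreg I)%:Z <= reg I) ->
  forall I : {mpoly K[n]} -> Prop,
    monomial_ideal I -> nonzero_ideal I -> (hreg I)%:Z <= reg I.
Proof.
move=> H I /monomial_idealP[U IU] [p Ip p0].
have U0 : exists c, U c.
  move: p0; rewrite -msupp_eq0; case E : (msupp p) => [//|c l] _; exists c.
  by apply: (proj1 (proj2 IU p) Ip); rewrite E mem_head.
have [r [-> rJ Jgen [c Uc cr]]] := truncation_at_reg IU U0.
have JU := monomials_of_truncation r IU.
rewrite lez_nat; apply: (hreg_truncation IU); rewrite -lez_nat -rJ; apply: H.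
- exact: monomials_of_monomial JU.
- exists 'X_[c]; first by apply/(monomials_ofX c JU); rewrite cr.
  by rewrite -msupp_eq0 msuppX.
- by exists r.
Qed.
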